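(* Star Decomposition is in XP with respect to the vertex cover number $\mathrm{vc}$ of the input graph. More precisely, if a vertex cover of size $\mathrm{vc}$ of the $n$-vertex input graph is given, then Star Decomposition can be solved in time $O\big((n+5^{\mathrm{vc}})^{5^{\mathrm{vc}}}\, n^{\mathrm{vc}}\big)$.
   Context: Star Decomposition problem: given a simple graph $G=(V,E)$ and vectors of positive integers $\mathbf{s}=(s_1,\ldots,s_d)$ (distinct star lengths) and $\mathbf{a}=(a_1,\ldots,a_d)$ (multiplicities) with $\sum_i a_is_i=|E|$, decide whether $E$ can be partitioned into the edge sets of subgraphs each isomorphic to a star $K_{1,\ell}$, with exactly $a_i$ of them isomorphic to $K_{1,s_i}$ for each $i\in[d]$. *)

(* Defs.v *)
From mathcomp Require Import all_boot.

Set Implicit Arguments.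
Unset Strict Implicit.
Unset Printing Implicit Defensive.

(** * Graphs and star decompositions *)

Record sgraph (T : finType) := SGraph {
  adj :> rel T;
  adj_sym : symmetric adj;
  adj_irr : irreflexive adj
}.

Definition edges (T : finType) (G : sgraph T) : {set {set T}} :=
  [set [set p.1; p.2] | p : T * T & G p.1 p.2].

Definition star_rel (l : nat) : rel (option 'I_l) :=
  fun x y => (x == None) (+) (y == None).

Lemma star_rel_sym l : symmetric (@star_rel l).
Proof. by move=> x y; rewrite /star_rel addbC. Qed.

Lemma star_rel_irr l : irreflexive (@star_rel l).
Proof. by move=> x; rewrite /star_rel addbb. Qed.

(* K_{1,l}: the centre is None, the leaves are the Some i. *)
Definition star (l : nat) : sgraph (option 'I_l) :=
  SGraph (@star_rel_sym l) (@star_rel_irr l).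

(* Subgraphs are given by a set of vertices and a set of edges, and need not
   be induced. *)
Definition is_subgraph (T : finType) (G : sgraph T)
    (W : {set T}) (F : {set {set T}}) : bool :=
  (F \subset edges G) && [forall e in F, e \subset W].

Definition isomorphic_to (U T : finType) (H : sgraph U)
    (W : {set T}) (F : {set {set T}}) : bool :=
  [exists f : {ffun U -> T},
    [&& injectiveb f, f @: [set: U] == W
      & [forall x, forall y, H x y == ([set f x; f y] \in F)]]].

(* F is the edge set of a subgraph of G isomorphic to H. *)
Definition edge_set_of_copy (U T : finType) (H : sgraph U) (G : sgraph T)
    (F : {set {set T}}) : bool :=
  [exists W : {set T}, is_subgraph G W F && isomorphic_to H W F].

Definition vertex_cover (T : finType) (G : sgraph T) (X : {set T}) : bool :=
  [forall x, forall y, G x y ==> ((x \in X) || (y \in X))].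

Definition vc_number (T : finType) (G : sgraph T) : nat :=
  #|[arg min_(X < [set: T] | vertex_cover G X) #|X|]|.

Record sd_instance := SDInstance {
  sd_n : nat;
  sd_graph : sgraph 'I_sd_n;
  sd_d : nat;
  sd_s : sd_d.-tuple nat;
  sd_a : sd_d.-tuple nat;
  sd_s_uniq : uniq sd_s;
  sd_s_pos : forall i : 'I_sd_d, 0 < tnth sd_s i;
  sd_a_pos : forall i : 'I_sd_d, 0 < tnth sd_a i;
  sd_total : \sum_(i < sd_d) tnth sd_a i * tnth sd_s i = #|edges sd_graph|
}.

Definition star_decomposable (I : sd_instance) : Prop :=
  let G := sd_graph I in
  exists P : {set {set {set 'I_(sd_n I)}}},
    [/\ partition P (edges G),
        forall F, F \in P -> exists l : nat, edge_set_of_copy (star l) G F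
      & forall i : 'I_(sd_d I),
          #|[set F in P | edge_set_of_copy (star (tnth (sd_s I) i)) G F]|
            = tnth (sd_a I) i].

(** * Unit-cost random access machines

    The machine is the additive unit-cost RAM: constants, indirect addressing,
    addition and truncated subtraction, but no multiplication, since unit-cost
    multiplication of unbounded integers is not a realistic operation.
    Programs use structured control flow. The memory consists of arrays of
    natural numbers.  Array names are constants of the program, so
    a program touches finitely many arrays, and interleaving these in a single
    memory costs only a constant factor. *)

Definition memory := nat -> nat -> nat.

Inductive expr :=
  | Lit of nat
  | Read of nat & expr
  | Add of expr & expr
  | Sub of expr & expr.

Inductive cmd :=
  | Skip
  | Write of nat & expr & expr
  | Seq of cmd & cmd
  | If of expr & cmd & cmd
  | While of expr & cmd.

Fixpoint eval (m : memory) (e : expr) : nat :=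
  match e with
  | Lit k => k
  | Read b e1 => m b (eval m e1)
  | Add e1 e2 => eval m e1 + eval m e2
  | Sub e1 e2 => eval m e1 - eval m e2
  end.

Fixpoint ecost (e : expr) : nat :=
  match e with
  | Lit _ => 1
  | Read _ e1 => (ecost e1).+1
  | Add e1 e2 | Sub e1 e2 => (ecost e1 + ecost e2).+1
  end.

Definition update (m : memory) (b i v : nat) : memory :=
  fun b' i' => if (b' == b) && (i' == i) then v else m b' i'.

(* exec c m t m': started in memory m, the command c halts after t elementary
   steps in memory m'.  A test succeeds when its value is nonzero. *)
Inductive exec : cmd -> memory -> nat -> memory -> Prop :=
  | exec_skip m : exec Skip m 1 m
  | exec_write m b e1 e2 :
      exec (Write b e1 e2) m (ecost e1 + ecost e2).+1
           (update m b (eval m e1) (eval m e2))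
  | exec_seq c1 c2 m1 m2 m3 t1 t2 :
      exec c1 m1 t1 m2 -> exec c2 m2 t2 m3 ->
      exec (Seq c1 c2) m1 (t1 + t2) m3
  | exec_if_true e c1 c2 m m' t :
      eval m e != 0 -> exec c1 m t m' ->
      exec (If e c1 c2) m (ecost e + t).+1 m'
  | exec_if_false e c1 c2 m m' t :
      eval m e = 0 -> exec c2 m t m' ->
      exec (If e c1 c2) m (ecost e + t).+1 m'
  | exec_while_true e c m1 m2 m3 t1 t2 :
      eval m1 e != 0 -> exec c m1 t1 m2 -> exec (While e c) m2 t2 m3 ->
      exec (While e c) m1 (ecost e + t1 + t2).+1 m3
  | exec_while_false e c m :
      eval m e = 0 -> exec (While e c) m (ecost e).+1 m.

(* The i-th list of the input is stored in array i; all other cells are 0. *)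
Definition load (w : seq (seq nat)) : memory :=
  fun b i => nth 0 (nth [::] w b) i.

(* Number of machine words of an input; it is at most its length in bits. *)
Definition input_size (w : seq (seq nat)) : nat := sumn (map size w).

Definition output (m : memory) : nat := m 0 0.

Definition decides_within (p : cmd) (w : seq (seq nat)) (T : nat)
    (yes : Prop) : Prop :=
  exists t m, [/\ exec p (load w) t m, t <= T
    & (output m = 1 /\ yes) \/ (output m = 0 /\ ~ yes)].

Definition computable (f : nat -> nat) : Prop :=
  exists p : cmd, forall k, exists t m,
    exec p (load [:: [:: k]]) t m /\ output m = f k.

(** * The class XP *)

(* The parameter is a function of the instance and is not part of the input. *)
Definition in_XP (A : Type) (enc : A -> seq (seq nat)) (yes : A -> Prop)
    (param : A -> nat) : Prop :=
  exists (f g : nat -> nat) (p : cmd),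
    [/\ computable f, computable g
      & forall x : A,
          decides_within p (enc x)
            (f (param x) * input_size (enc x) ^ g (param x)) (yes x)].

(** * Encoding of instances *)

(* Adjacency matrix in row-major order: G i j is at position i * n + j. *)
Definition adj_matrix (n : nat) (G : sgraph 'I_n) : seq nat :=
  [seq nat_of_bool (G i j) | i <- enum 'I_n, j <- enum 'I_n].

Definition sd_encode (I : sd_instance) : seq (seq nat) :=
  [:: [:: sd_n I; sd_d I]; adj_matrix (sd_graph I);
      tval (sd_s I); tval (sd_a I)].

Definition sd_encode_cover (I : sd_instance) (X : seq 'I_(sd_n I)) :
    seq (seq nat) :=
  sd_encode I ++ [:: [:: size X]; map val X].

Definition sd_vc (I : sd_instance) : nat := vc_number (sd_graph I).

(* Main.v *)
Require Import Defs.
From mathcomp Require Import all_boot.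
From mathcomp Require Import zify.

Set Implicit Arguments.
Unset Strict Implicit.
Unset Printing Implicit Defensive.

(** Sending every edge to the centre of its star turns a star decomposition
    into an orientation of the edges together with a distribution of the stars
    among the vertices, such that at every vertex v the sizes of its stars add
    up to the number of edges centred at v.  Fix a vertex cover
    x_0, ..., x_(k-1).  A vertex outside of it has degree at most k, hence only
    carries stars of size at most k, and a partial choice is described by 2k
    counters: for each j, the number of edges centred at x_j, and for each
    s <= k, the number of stars of size s used outside of the cover.  In base
    B = 2n^2 + 1, which exceeds all counters, such a state is a single number,
    and each choice adds or subtracts a constant; so a sequence of bit vectors
    of length (k+1)B^(2k) computes all reachable states.  Its top digit is
    scratch space: it counts the edges centred at the outer vertex being
    processed that are not yet grouped into stars.  The stars of the instance
    are finally subtracted, and the answer is whether 0 is reachable.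

    For XP, the cover consists of the endpoints of a greedy maximal matching
    and has at most 2 vc vertices. *)

(** * Programs with time bounds *)

Notation "a [+] b" := (Add a b) (at level 50, left associativity).
Notation "a [-] b" := (Defs.Sub a b) (at level 50, left associativity).

Definition halts (c : cmd) (m : memory) (T : nat) (Q : memory -> Prop) : Prop :=
  exists t m', [/\ exec c m t m', t <= T & Q m'].

Lemma halts_weak c m T T' (Q Q' : memory -> Prop) :
  halts c m T Q -> T <= T' -> (forall m', Q m' -> Q' m') -> halts c m T' Q'.
Proof.
move=> [t [m' [ex le q]]] leT QQ'; exists t, m'; split=> //.
- exact: leq_trans leT.
- exact: QQ'.
Qed.

Lemma halts_time c m T T' Q : halts c m T Q -> T <= T' -> halts c m T' Q.
Proof. by move=> H le; apply: halts_weak H le _. Qed.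

Lemma halts_skip m (Q : memory -> Prop) : Q m -> halts Skip m 1 Q.
Proof. by move=> q; exists 1, m; split=> //; constructor. Qed.

Lemma halts_write m b e1 e2 (Q : memory -> Prop) :
  Q (update m b (eval m e1) (eval m e2)) ->
  halts (Write b e1 e2) m (ecost e1 + ecost e2).+1 Q.
Proof. by move=> q; do 2!eexists; split; [constructor | | exact: q]. Qed.

Lemma halts_seq c1 c2 m T1 T2 (Q : memory -> Prop) :
  halts c1 m T1 (fun m1 => halts c2 m1 T2 Q) -> halts (Seq c1 c2) m (T1 + T2) Q.
Proof.
move=> [t1 [m1 [ex1 le1 [t2 [m2 [ex2 le2 q]]]]]].
exists (t1 + t2), m2; split=> //; first exact: exec_seq ex1 ex2.
exact: leq_add.
Qed.

Lemma halts_if e c1 c2 m T (Q : memory -> Prop) :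
  (eval m e != 0 -> halts c1 m T Q) -> (eval m e = 0 -> halts c2 m T Q) ->
  halts (If e c1 c2) m (ecost e + T).+1 Q.
Proof.
move=> H1 H2; have [e0|e0] := eqVneq (eval m e) 0.
  have [t [m' [ex le q]]] := H2 e0.
  exists (ecost e + t).+1, m'; split=> //; first exact: exec_if_false.
  by rewrite ltnS leq_add2l.
have [t [m' [ex le q]]] := H1 e0.
exists (ecost e + t).+1, m'; split=> //; first exact: exec_if_true.
by rewrite ltnS leq_add2l.
Qed.

Definition Var (x : nat) : expr := Read x (Lit 0).

Definition assign (x : nat) (e : expr) : cmd := Write x (Lit 0) e.

Definition For (x : nat) (e : expr) (c : cmd) : cmd :=
  Seq (assign x (Lit 0))
      (While (e [-] Var x) (Seq c (assign x (Var x [+] Lit 1)))).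

Lemma update_eq m b i v : update m b i v b i = v.
Proof. by rewrite /update !eqxx. Qed.

Lemma halts_for x e c N (T : nat -> nat) (Inv : nat -> memory -> Prop) m
    (Q : memory -> Prop) :
  (forall i m1 v, Inv i m1 -> Inv i (update m1 x 0 v)) ->
  (forall i m1, Inv i m1 -> eval m1 e = N) ->
  Inv 0 m ->
  (forall i m1, i < N -> Inv i m1 -> m1 x 0 = i ->
     halts c m1 (T i) (fun m2 => m2 x 0 = i /\ Inv i.+1 m2)) ->
  (forall m1, Inv N m1 -> Q m1) ->
  halts (For x e c) m (\sum_(i < N) (T i + (ecost e + 12)) + (ecost e + 12)) Q.
Proof.
move=> Hx He H0 Hb HQ.
suff H i m1 : i <= N -> Inv i m1 -> m1 x 0 = i ->
    halts (While (e [-] Var x) (Seq c (assign x (Var x [+] Lit 1)))) m1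
       (\sum_(i <= j < N) (T j + (ecost e + 12)) + (ecost e + 4)) Q.
  apply: (@halts_time _ _ (3 + (\sum_(0 <= j < N) (T j + (ecost e + 12))
                               + (ecost e + 4)))).
    apply: halts_seq; apply: halts_write; apply: H => //; first exact: Hx.
    exact: update_eq.
  by rewrite big_mkord; lia.
move=> leiN; move Ek: (N - i) => k.
elim: k i m1 leiN Ek => [|k IH] i m1 leiN Ek Hi xi.
  have EN : i = N by lia.
  move: Hi xi; rewrite EN => Hi xi; exists (ecost (e [-] Var x)).+1, m1; split.
  - by apply: exec_while_false => /=; rewrite (He _ _ Hi) xi subnn.
  - by rewrite big_geq //=; lia.
  - exact: HQ.
have ltiN : i < N by lia.
have [t1 [m2 [ex1 le1 [x2 Hi2]]]] := Hb _ _ ltiN Hi xi.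
have Hi3 := Hx _ _ i.+1 Hi2.
have [||t2 [m3 [ex2 le2 q]]] := IH _ _ ltiN _ Hi3; first by lia.
  exact: update_eq.
exists (ecost (e [-] Var x) + (t1 + 6) + t2).+1, m3; split=> //.
  apply: exec_while_true ex2; first by rewrite /= (He _ _ Hi) xi; lia.
  apply: exec_seq ex1 _.
  have -> : i.+1 = eval m2 (Var x [+] Lit 1) by rewrite /= x2 addn1.
  exact: exec_write.
by rewrite big_ltn //=; lia.
Qed.

Definition agree (l : seq nat) (m m' : memory) : Prop :=
  forall b i, b \notin l -> m' b i = m b i.

Lemma agree_refl l m : agree l m m.
Proof. by []. Qed.

Lemma agree_update l m m' b i v :
  b \in l -> agree l m m' -> agree l m (update m' b i v).
Proof.
move=> bl H b' i' b'l; rewrite /update; case: eqP => [E|_] /=.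
  by rewrite E bl in b'l.
exact: H.
Qed.

Lemma agree_step l L m1 m2 m3 :
  all (mem L) l -> agree L m1 m2 -> agree l m2 m3 -> agree L m1 m3.
Proof.
move=> /allP s H12 H23 b i bl; rewrite H23 ?H12 //.
by apply: contra bl; apply: s.
Qed.

Lemma halts_for_const x e c N T (Inv : nat -> memory -> Prop) m
    (Q : memory -> Prop) :
  (forall i m1 v, Inv i m1 -> Inv i (update m1 x 0 v)) ->
  (forall i m1, Inv i m1 -> eval m1 e = N) ->
  Inv 0 m ->
  (forall i m1, i < N -> Inv i m1 -> m1 x 0 = i ->
     halts c m1 T (fun m2 => m2 x 0 = i /\ Inv i.+1 m2)) ->
  (forall m1, Inv N m1 -> Q m1) ->
  halts (For x e c) m (N * (T + (ecost e + 12)) + (ecost e + 12)) Q.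
Proof.
move=> Hx He H0 Hb HQ.
apply: halts_time (halts_for Hx He H0 Hb HQ) _.
by rewrite sum_nat_const card_ord.
Qed.

Lemma agreeW l L m m' : all (mem L) l -> agree l m m' -> agree L m m'.
Proof. by move=> s; apply: agree_step. Qed.

Lemma loop_le N T K a U :
  0 < U -> T <= a * U -> N * (T + K) + K <= (a + K) * (N.+1 * U).
Proof.
move=> U0 le; apply: (@leq_trans (N.+1 * (T + K))).
  by rewrite mulSn addnC leq_add2r leq_addl.
rewrite mulnCA leq_mul2l /=; apply: leq_trans (_ : a * U + K * U <= _).
  by apply: leq_add => //; rewrite leq_pmulr.
by rewrite mulnDl.
Qed.

(** * The dynamic program *)

Definition shift : Type := (nat * nat * nat)%type.

Definition shifts (mv : shift) (c c' : nat) : Prop :=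
  exists t, [/\ t < mv.2, c = mv.1.1 + t & c' = mv.1.2 + t].

Definition gstep (g : seq shift) (c c' : nat) : Prop :=
  exists2 mv, mv \in g & shifts mv c c'.

Fixpoint reach (gs : seq (seq shift)) (c c' : nat) : Prop :=
  if gs is g :: gs' then exists2 c1, gstep g c c1 & reach gs' c1 c' else c = c'.

Lemma reach_cat gs1 gs2 c c' :
  reach (gs1 ++ gs2) c c' <-> exists2 c1, reach gs1 c c1 & reach gs2 c1 c'.
Proof.
elim: gs1 c => [|g gs1 IH] c /=.
  by split=> [H|[c1 -> //]]; exists c.
split=> [[c1 H1 /IH [c2 H2 H3]]|[c2 [c1 H1 H2] H3]].
  by exists c2 => //; exists c1.
by exists c1 => //; apply/IH; exists c2.
Qed.

Definition cats (N : nat) (T : Type) (f : nat -> seq T) : seq T :=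
  flatten [seq f i | i <- iota 0 N].

Lemma cats_nil T (f : nat -> seq T) : cats 0 f = [::].
Proof. by []. Qed.

Lemma catsS N T (f : nat -> seq T) : cats N.+1 f = cats N f ++ f N.
Proof.
by rewrite /cats -addn1 iotaD map_cat flatten_cat /= cats0 add0n.
Qed.

(* The data of an instance, with the cover listed as px 0, ..., px (pk - 1). *)
Record inst := Inst {
  pn : nat; pd : nat; padj : nat -> nat -> bool;
  ps : nat -> nat; pa : nat -> nat; pk : nat; px : nat -> nat
}.

Definition base (I : inst) : nat := (pn I * (pn I + pn I)).+1.
Definition wt (I : inst) (j : nat) : nat := base I ^ j.
Definition big (I : inst) : nat := wt I (pk I + pk I).
Definition top (I : inst) : nat := (pk I).+1 * big I.
Definition covered (I : inst) (v : nat) : bool :=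
  v \in [seq px I j | j <- iota 0 (pk I)].

Definition addm (I : inst) (w : nat) : shift := (0, w, top I - w).
Definition subm (I : inst) (w : nat) : shift := (w, 0, top I - w).

Definition ops_pair (I : inst) (i j : nat) : seq (seq shift) :=
  if padj I (px I i) (px I j)
  then [:: [:: addm I (wt I i); addm I (wt I j)]] else [::].

Definition ops_cover (I : inst) : seq (seq shift) :=
  cats (pk I) (fun i => cats i (ops_pair I i)).

Definition ops_edge (I : inst) (v j : nat) : seq (seq shift) :=
  if padj I v (px I j)
  then [:: [:: addm I (wt I j); addm I (big I)]] else [::].

Definition ops_edges (I : inst) (v : nat) : seq (seq shift) :=
  cats (pk I) (ops_edge I v).

Definition conv (I : inst) (s : nat) : seq shift :=
  [:: (0, 0, top I);
      (s.+1 * big I, wt I (pk I + s), top I - s.+1 * big I)].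

Definition ops_conv (I : inst) : seq (seq shift) :=
  cats (pk I) (fun s => cats (pk I) (fun=> [:: conv I s])).

Definition ops_vertex (I : inst) (v : nat) : seq (seq shift) :=
  if covered I v then [::]
  else ops_edges I v ++ (ops_conv I ++ [:: [:: (0, 0, big I)]]).

Definition star_shifts (I : inst) (s : nat) : seq shift :=
  cats (pk I) (fun j => [:: subm I (s * wt I j)]) ++
  (if s <= pk I then [:: subm I (wt I (pk I + s - 1))] else [::]).

Definition ops_stars (I : inst) : seq (seq shift) :=
  cats (pd I) (fun i => cats (pa I i) (fun=> [:: star_shifts I (ps I i)])).

Definition ops (I : inst) : seq (seq shift) :=
  ops_cover I ++ (cats (pn I) (ops_vertex I) ++ ops_stars I).

Lemma wt_gt0 I j : 0 < wt I j.
Proof. by rewrite /wt expn_gt0. Qed.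

Lemma wt_le_big I j : j <= pk I + pk I -> wt I j <= big I.
Proof. by move=> le; rewrite /big /wt leq_pexp2l. Qed.

Lemma big_le_top I : big I <= top I.
Proof. by rewrite /top mulSn leq_addr. Qed.

(* Memory layout: 0-5 input; 6 layers of marks; 7 powers of the base; 8 marks of
   cover vertices; 9 row offsets of the adjacency matrix; 10 start cur of the
   current layer; 11-14 arguments and counter of transfer; 15 top; 16 big;
   17 base; 18-26 loop counters and scratch; 27-28 used by prog_matching only.
   Layer [cur, cur + top) of array 6 marks the codes reached after the groups
   gs; the next layer collects the images under the shifts in g. *)
Definition dp (I : inst) (m : memory) (gs : seq (seq shift)) (g : seq shift) :
    Prop :=
  (forall c, c < top I -> m 6 (m 10 0 + c) != 0 <-> reach gs 0 c) /\
  (forall c, m 6 (m 10 0 + top I + c) != 0 <->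
     exists2 c0, reach gs 0 c0 & gstep g c0 c).

Definition valid (I : inst) (mv : shift) : Prop :=
  forall t, t < mv.2 -> mv.1.1 + t < top I /\ mv.1.2 + t < top I.

Lemma valid_addm I w : valid I (addm I w).
Proof. by move=> t /=; lia. Qed.

Lemma valid_subm I w : valid I (subm I w).
Proof. by move=> t /=; lia. Qed.

Lemma gstep_rcons g mv c c' :
  gstep (rcons g mv) c c' <-> gstep g c c' \/ shifts mv c c'.
Proof.
split=> [[mv' /[!(mem_rcons, inE)] /orP[/eqP ->|H] S]|[[mv' H S]|S]].
- by right.
- by left; exists mv'.
- by exists mv' => //; rewrite mem_rcons inE H orbT.
- by exists mv => //; rewrite mem_rcons inE eqxx.
Qed.

Definition transfer (eo ed eb : expr) : cmd :=
  Seq (assign 11 eo) (Seq (assign 12 ed) (Seq (assign 13 eb)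
  (For 14 (Var 13)
    (If (Read 6 (Var 10 [+] Var 11 [+] Var 14))
        (Write 6 (Var 10 [+] Var 15 [+] Var 12 [+] Var 14) (Lit 1)) Skip)))).

Definition advance : cmd := assign 10 (Var 10 [+] Var 15).

Lemma halts_transfer I m gs g eo ed eb mv (Q : memory -> Prop) :
  m 15 0 = top I -> dp I m gs g -> valid I mv ->
  (forall m', agree [:: 11; 12; 13] m m' ->
     [/\ eval m' eo = mv.1.1, eval m' ed = mv.1.2 & eval m' eb = mv.2]) ->
  (forall m', agree [:: 6; 11; 12; 13; 14] m m' ->
     dp I m' gs (rcons g mv) -> Q m') ->
  halts (transfer eo ed eb) m
     (ecost eo + ecost ed + ecost eb + 60 * (top I).+1) Q.
Proof.
move=> Etop [D1 D2] V E HQ.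
set cur := m 10 0 in D1 D2.
have [E1 _ _] := E m (@agree_refl _ m).
pose m1 := update m 11 0 mv.1.1.
have A1 : agree [:: 11; 12; 13] m m1 by apply: agree_update.
have [_ E2 _] := E m1 A1.
pose m2 := update m1 12 0 mv.1.2.
have A2 : agree [:: 11; 12; 13] m m2 by apply: agree_update.
have [_ _ E3] := E m2 A2.
pose m3 := update m2 13 0 mv.2.
have leb : mv.2 <= top I.
  by case: (posnP mv.2) => [-> //|b0]; have := V mv.2.-1; lia.
pose Inv t (m4 : memory) := agree [:: 6; 14] m3 m4 /\
    forall i, m4 6 i != 0 <-> m 6 i != 0 \/
      exists t', [/\ t' < t, m 6 (cur + mv.1.1 + t') != 0
                 & i = cur + top I + mv.1.2 + t'].
eapply halts_time.
eapply halts_seq; eapply halts_write; rewrite [eval _ _]/= E1 -/m1.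
eapply halts_seq; eapply halts_write; rewrite [eval _ _]/= E2 -/m2.
eapply halts_seq; eapply halts_write; rewrite [eval _ _]/= E3 -/m3.
eapply (@halts_for_const _ _ _ mv.2 _ Inv).
- move=> i m4 v [A H]; split; first by apply: agree_update.
  by move=> i'; rewrite -H /update.
- by move=> i m4 [A _] /=; rewrite A //.
- split=> // i; split=> [H|[//|[t' [//]]]]; first by left.
- move=> t m4 ltt [A H] Et.
  have R6 : eval m4 (Var 10 [+] Var 11 [+] Var 14) = cur + mv.1.1 + t.
    by rewrite /= Et !A.
  have W6 : eval m4 (Var 10 [+] Var 15 [+] Var 12 [+] Var 14)
      = cur + top I + mv.1.2 + t by rewrite /= Et !A //= -Etop.
  have [lt1 lt2] := V _ ltt.
  have K6 : m4 6 (cur + mv.1.1 + t) != 0 <-> m 6 (cur + mv.1.1 + t) != 0.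
    rewrite H; split=> [[//|[t' [_ _ ]]]|]; first by lia.
    by left.
  apply: (@halts_time _ _ (9 + 13).+1); last by [].
  apply: halts_if => [|].
    rewrite [eval m4 (Read _ _)]/= -/(eval m4 (Var 10 [+] Var 11 [+] Var 14)).
    rewrite R6 => nz; apply: halts_write.
    rewrite W6; split=> //; split; first by apply: agree_update.
    move=> i; rewrite /update /=.
    case: (i =P _) => [->|ne].
      split=> // _; right; exists t; split=> //; exact/K6.
    rewrite H; split=> [[H1|[t' [h1 h2 h3]]]|[H1|[t' [h1 h2 h3]]]]; try by left.
      by right; exists t'; split=> //; apply: ltnW.
    right; exists t'; split=> //.
    by move: h1; rewrite ltnS leq_eqVlt => /orP[/eqP e|//]; subst.
  rewrite [eval m4 _]/= -/(eval m4 (Var 10 [+] Var 11 [+] Var 14)) R6 => z.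
  apply: (@halts_time _ _ 1) => //; apply: halts_skip; split=> //; split=> // i.
  rewrite H; split=> [[H1|[t' [h1 h2 h3]]]|[H1|[t' [h1 h2 h3]]]]; try by left.
    by right; exists t'; split=> //; apply: ltnW.
  right; exists t'; split=> //.
  move: h1; rewrite ltnS leq_eqVlt => /orP[/eqP e|//]; subst.
  by move/K6: h2; rewrite z.
move=> m4 [A H]; apply: HQ.
  move=> b i; rewrite !inE !negb_or => /and5P[n1 n2 n3 n4 n5].
  rewrite A ?inE ?negb_or ?n1 // /m3 /m2 /m1 /update.
  by rewrite (negPf n2) (negPf n3) (negPf n4).
have Ecur : m4 10 0 = cur by rewrite A.
split=> c; rewrite Ecur.
  move=> ltc; rewrite H D1 //; split=> [[//|[t' [_ _ ]]]|]; first by lia.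
  by left.
rewrite H D2; split.
  move=> [[c0 r s]|[t [h1 h2 h3]]].
    by exists c0 => //; apply/gstep_rcons; left.
  have [lt1 lt2] := V _ h1.
  exists (mv.1.1 + t); first by apply/D1; rewrite // addnA.
  by apply/gstep_rcons; right; exists t; split=> //; lia.
move=> [c0 r /gstep_rcons[s|[t [h1 h2 h3]]]]; first by left; exists c0.
right; exists t; have [lt1 lt2] := V _ h1; split=> //; last by lia.
by rewrite -addnA; apply/D1 => //; rewrite -h2.
by rewrite /=; lia.
Qed.

Lemma halts_advance I m gs g (Q : memory -> Prop) :
  m 15 0 = top I -> dp I m gs g ->
  (forall mv, mv \in g -> valid I mv) ->
  (forall m', agree [:: 10] m m' ->
     dp I m' (gs ++ [:: g]) [::] -> Q m') ->
  halts advance m 7 Q.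
Proof.
move=> Etop [D1 D2] V HQ.
apply: halts_write; apply: HQ; first by apply: agree_update.
have lt c c' : gstep g c c' -> c' < top I.
  by move=> [mv /V v [t [/v [_ lt] _ ->]]].
have rc c : reach (gs ++ [:: g]) 0 c <->
    exists2 c0, reach gs 0 c0 & gstep g c0 c.
  rewrite reach_cat; split=> [[c0 r [c1 s <-]]|[c0 r s]]; exists c0 => //.
  by exists c.
rewrite /= Etop; split=> c; rewrite {1}/update {1}/update /=.
  by move=> ltc; rewrite D2 rc.
rewrite -[m 10 0 + _ + _ + _]addnA D2; split=> [[c0 r /lt]|[c0 r [mv]]];
  last by [].
by lia.
Qed.

Lemma dp_update I m gs g b i v :
  b != 6 -> b != 10 -> dp I m gs g -> dp I (update m b i v) gs g.
Proof.
move=> n6 n10 [D1 D2].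
have E j : update m b i v 6 j = m 6 j by rewrite /update eq_sym (negPf n6).
have E' j : update m b i v 10 j = m 10 j by rewrite /update eq_sym (negPf n10).
by split=> c; rewrite !(E, E'); [apply: D1 | apply: D2].
Qed.

Lemma halts_for_dp I x e c N (T : nat -> nat) L m gs f (Q : memory -> Prop) :
  x \in L -> x != 6 -> x != 10 ->
  (forall m1, agree L m m1 -> eval m1 e = N) ->
  dp I m gs [::] ->
  (forall i m1 gs1 (Q1 : memory -> Prop), i < N -> agree L m m1 -> m1 x 0 = i ->
     dp I m1 gs1 [::] ->
     (forall m2, m2 x 0 = i -> agree L m m2 -> dp I m2 (gs1 ++ f i) [::] ->
       Q1 m2) ->
     halts c m1 (T i) Q1) ->
  (forall m', agree L m m' -> dp I m' (gs ++ cats N f) [::] -> Q m') ->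
  halts (For x e c) m (\sum_(i < N) (T i + (ecost e + 12)) + (ecost e + 12)) Q.
Proof.
move=> xL n6 n10 He D Hb HQ.
apply: (@halts_for _ _ _ N T (fun i m1 => agree L m m1 /\
          dp I m1 (gs ++ cats i f) [::])).
- move=> i m1 v [A D1]; split; first exact: agree_update.
  exact: dp_update.
- by move=> i m1 [A _]; apply: He.
- by rewrite cats_nil cats0.
- move=> i m1 lti [A D1] xi; apply: (Hb _ _ _ _ lti A xi D1) => m2 x2 A2 D2.
  by split=> //; split=> //; rewrite catsS catA.
- by move=> m1 [A D1]; apply: HQ.
Qed.

Lemma halts_for_dp_const I x e c N T L m gs f (Q : memory -> Prop) :
  x \in L -> x != 6 -> x != 10 ->
  (forall m1, agree L m m1 -> eval m1 e = N) ->
  dp I m gs [::] ->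
  (forall i m1 gs1 (Q1 : memory -> Prop), i < N -> agree L m m1 -> m1 x 0 = i ->
     dp I m1 gs1 [::] ->
     (forall m2, m2 x 0 = i -> agree L m m2 -> dp I m2 (gs1 ++ f i) [::] ->
       Q1 m2) ->
     halts c m1 T Q1) ->
  (forall m', agree L m m' -> dp I m' (gs ++ cats N f) [::] -> Q m') ->
  halts (For x e c) m (N * (T + (ecost e + 12)) + (ecost e + 12)) Q.
Proof.
move=> xL n6 n10 He D Hb HQ.
apply: (halts_time (halts_for_dp (T := fun=> T) xL n6 n10 He D Hb HQ)).
by rewrite sum_nat_const card_ord.
Qed.

Record input (I : inst) (m : memory) : Prop := Input {
  in_n : m 0 0 = pn I;
  in_d : m 0 1 = pd I;
  in_adj : forall u v, u < pn I -> v < pn I ->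
    (m 1 (u * pn I + v) != 0) = padj I u v;
  in_s : forall i, i < pd I -> m 2 i = ps I i;
  in_a : forall i, i < pd I -> m 3 i = pa I i;
  in_k : m 4 0 = pk I;
  in_x : forall j, j < pk I -> m 5 j = px I j
}.

Record tables (I : inst) (m : memory) : Prop := Tables {
  tb_wt : forall j, j < pk I + pk I -> m 7 j = wt I j;
  tb_cov : forall v, v < pn I -> (m 8 v != 0) = covered I v;
  tb_row : forall v, v < pn I -> m 9 v = v * pn I;
  tb_top : m 15 0 = top I;
  tb_big : m 16 0 = big I
}.

Definition dpvars : seq nat :=
  [:: 6; 10; 11; 12; 13; 14; 18; 19; 20; 21; 22; 23; 24; 25; 26].

Lemma input_agree I m m' : agree dpvars m m' -> input I m -> input I m'.
Proof.
move=> A [h1 h2 h3 h4 h5 h6 h7].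
by split=> *; rewrite A //; do ?[exact: h3 | exact: h4 | exact: h5 | exact: h7].
Qed.

Lemma tables_agree I m m' : agree dpvars m m' -> tables I m -> tables I m'.
Proof.
move=> A [h1 h2 h3 h4 h5].
by split=> *; rewrite A //; do ?[exact: h1 | exact: h2 | exact: h3].
Qed.

Definition prog_cover : cmd :=
  For 18 (Var 4) (For 19 (Var 18)
    (If (Read 1 (Read 9 (Read 5 (Var 18)) [+] Read 5 (Var 19)))
      (Seq (transfer (Lit 0) (Read 7 (Var 18)) (Var 15 [-] Read 7 (Var 18)))
      (Seq (transfer (Lit 0) (Read 7 (Var 19)) (Var 15 [-] Read 7 (Var 19)))
           advance))
      Skip)).


Lemma halts_cover I m gs (Q : memory -> Prop) :
  (forall j, j < pk I -> px I j < pn I) ->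
  input I m -> tables I m -> dp I m gs [::] ->
  (forall m', agree [:: 6; 10; 11; 12; 13; 14; 18; 19] m m' ->
     dp I m' (gs ++ ops_cover I) [::] -> Q m') ->
  halts prog_cover m (300 * ((pk I).+1 * ((pk I).+1 * (top I).+1))) Q.
Proof.
move=> Hx HI HT D HQ.
set U := (top I).+1.
apply: (@halts_time _ _ (pk I * (214 * ((pk I).+1 * U) + (2 + 12)) + (2 + 12)));
  last first.
  apply: leq_trans (loop_le (pk I) 14 _ (leqnn (214 * ((pk I).+1 * U)))) _ =>
    //.
  by rewrite leq_mul2r orbT.
apply: (@halts_for_dp_const I 18 _ _ _ _
     [:: 6; 10; 11; 12; 13; 14; 18; 19] _ gs _ _ _ _ _ _ D _ HQ) => //.
  by move=> m1 A /=; rewrite A // (in_k HI).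
move=> i m1 gs1 Q1 lti A1 x1 D1 HQ1.
apply: (@halts_time _ _ (i * (200 * U + (2 + 12)) + (2 + 12))); last first.
  apply: leq_trans (loop_le i 14 _ (leqnn (200 * U))) _ => //.
  by rewrite leq_mul2l leq_mul2r ltnS ltnW // orbT.
apply: (@halts_for_dp_const I 19 _ _ _ _
       [:: 6; 10; 11; 12; 13; 14; 19] m1 gs1 (ops_pair I i) _ _ _ _ _ D1) => //.
- by move=> m2 A /=; rewrite A // x1.
- move=> j m2 gs2 Q2 ltj A2 x2 D2 HQ2.
  have ltjk := ltn_trans ltj lti.
  have A02 : agree dpvars m m2.
    by apply: agreeW (agree_step _ A1 A2).
  have HI2 := input_agree A02 HI; have HT2 := tables_agree A02 HT.
  have x18 : m2 18 0 = i by rewrite A2.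
  have E1 : m2 7 i = wt I i by apply: (tb_wt HT2); lia.
  have E2 : m2 7 j = wt I j by apply: (tb_wt HT2); lia.
  apply: (@halts_time _ _ (9 + (150 * U + 40)).+1); last by rewrite /U; lia.
  apply: halts_if.
    rewrite /= x18 x2 !(in_x HI2) // (tb_row HT2) ?Hx //.
    rewrite (in_adj HI2) ?Hx // => adj.
    eapply halts_time.
      eapply halts_seq; eapply (halts_transfer (mv := addm I (wt I i)) (tb_top
        HT2) D2).
      + exact: valid_addm.
      + by move=> m3 A /=; rewrite !A // x18 E1 (tb_top HT2).
      move=> m3 A3 D3; eapply halts_seq.
      have T3 : m3 15 0 = top I by rewrite A3 // (tb_top HT2).
      eapply (halts_transfer (mv := addm I (wt I j)) T3 D3).
      + exact: valid_addm.
      + by move=> m4 A /=; rewrite !A // !A3 // x2 E2 (tb_top HT2).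
      move=> m4 A4 D4; have T4 : m4 15 0 = top I by rewrite A4.
      eapply (halts_advance T4 D4).
      + move=> mv; rewrite !inE => /orP[] /eqP ->; exact: valid_addm.
      move=> m5 A5 D5; apply: HQ2.
      + by rewrite A5 // A4 // A3.
      + exact: agree_step (agree_step _ (agree_step _ A2 A3) A4) A5.
      by rewrite /ops_pair adj.
    by rewrite /= -/U; lia.
  rewrite /= x18 x2 !(in_x HI2) // (tb_row HT2) ?Hx // => adj.
  apply: (@halts_time _ _ 1); last by lia.
  apply: halts_skip; apply: HQ2 => //.
  have := in_adj HI2 (Hx _ lti) (Hx _ ltjk); rewrite adj eqxx => /esym nadj.
  by rewrite /ops_pair nadj cats0.
- move=> m2 A2 D2; apply: HQ1 D2.
    by rewrite A2.
  exact: agree_step A1 A2.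
Qed.

Definition prog_edges : cmd :=
  For 19 (Var 4)
    (If (Read 1 (Read 9 (Var 20) [+] Read 5 (Var 19)))
      (Seq (transfer (Lit 0) (Read 7 (Var 19)) (Var 15 [-] Read 7 (Var 19)))
      (Seq (transfer (Lit 0) (Var 16) (Var 15 [-] Var 16))
           advance))
      Skip).

Lemma halts_edges I m gs v (Q : memory -> Prop) :
  (forall j, j < pk I -> px I j < pn I) ->
  input I m -> tables I m -> m 20 0 = v -> v < pn I -> dp I m gs [::] ->
  (forall m', agree [:: 6; 10; 11; 12; 13; 14; 19] m m' ->
     dp I m' (gs ++ ops_edges I v) [::] -> Q m') ->
  halts prog_edges m (214 * ((pk I).+1 * (top I).+1)) Q.
Proof.
move=> Hx HI HT Ev ltv D HQ; set U := (top I).+1.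
apply: (@halts_time _ _ (pk I * (200 * U + (2 + 12)) + (2 + 12))); last first.
  exact: leq_trans (loop_le (pk I) 14 _ (leqnn (200 * U))) _.
apply: (@halts_for_dp_const I 19 _ _ _ _
       [:: 6; 10; 11; 12; 13; 14; 19] m gs (ops_edge I v) _ _ _ _ _ D) => //.
  by move=> m1 A /=; rewrite A // (in_k HI).
move=> j m2 gs2 Q2 ltj A2 x2 D2 HQ2.
have A02 : agree dpvars m m2 by apply: agreeW A2.
have HI2 := input_agree A02 HI; have HT2 := tables_agree A02 HT.
have x20 : m2 20 0 = v by rewrite A2.
have E2 : m2 7 j = wt I j by apply: (tb_wt HT2); lia.
apply: (@halts_time _ _ (8 + (150 * U + 40)).+1); last by rewrite /U; lia.
apply: halts_if.
  rewrite /= x20 x2 !(in_x HI2) // (tb_row HT2) ?Hx //.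
  rewrite (in_adj HI2) ?Hx // => adj.
  eapply halts_time.
    eapply halts_seq; eapply (halts_transfer (mv := addm I (wt I j)) (tb_top
      HT2) D2).
    + exact: valid_addm.
    + by move=> m3 A /=; rewrite !A // x2 E2 (tb_top HT2).
    move=> m3 A3 D3; eapply halts_seq.
      have T3 : m3 15 0 = top I by rewrite A3 // (tb_top HT2).
    eapply (halts_transfer (mv := addm I (big I)) T3 D3).
    + exact: valid_addm.
    + by move=> m4 A /=; rewrite !A // !A3 // (tb_big HT2) (tb_top HT2).
    move=> m4 A4 D4; have T4 : m4 15 0 = top I by rewrite A4.
      eapply (halts_advance T4 D4).
    + move=> mv; rewrite !inE => /orP[] /eqP ->; exact: valid_addm.
    move=> m5 A5 D5; apply: HQ2.
    + by rewrite A5 // A4 // A3.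
    + exact: agree_step (agree_step _ (agree_step _ A2 A3) A4) A5.
    by rewrite /ops_edge adj.
  by rewrite /= -/U; lia.
rewrite /= x20 x2 !(in_x HI2) // (tb_row HT2) ?Hx // => adj.
apply: (@halts_time _ _ 1); last by lia.
apply: halts_skip; apply: HQ2 => //.
have := in_adj HI2 ltv (Hx _ ltj); rewrite adj eqxx => /esym nadj.
by rewrite /ops_edge nadj cats0.
Qed.

Definition prog_conv : cmd :=
  Seq (assign 22 (Lit 0))
  (For 21 (Var 4)
    (Seq (assign 22 (Var 22 [+] Var 16))
    (For 23 (Var 4)
      (Seq (transfer (Lit 0) (Lit 0) (Var 15))
      (Seq (transfer (Var 22) (Read 7 (Var 4 [+] Var 21)) (Var 15 [-] Var 22))
           advance))))).

Lemma valid_conv I s mv : s < pk I -> mv \in conv I s -> valid I mv.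
Proof.
move=> lts; rewrite !inE => /orP[] /eqP -> t /= ltt; first by lia.
have le : wt I (pk I + s) <= big I by apply: wt_le_big; lia.
by rewrite mulSn in ltt *; lia.
Qed.

Lemma halts_conv I m gs (Q : memory -> Prop) :
  input I m -> tables I m -> dp I m gs [::] ->
  (forall m', agree [:: 6; 10; 11; 12; 13; 14; 21; 22; 23] m m' ->
     dp I m' (gs ++ ops_conv I) [::] -> Q m') ->
  halts prog_conv m (250 * ((pk I).+1 * ((pk I).+1 * (top I).+1))) Q.
Proof.
move=> HI HT D HQ; set U := (top I).+1.
pose L := [:: 6; 10; 11; 12; 13; 14; 21; 22; 23].
apply: (@halts_time _ _ (3 + (pk I * (220 * ((pk I).+1 * U) + (2 + 12)) + (2 +
  12)))); last first.
  apply: leq_trans (leq_add _ (loop_le (pk I) 14 _ (leqnn (220 * ((pk I).+1 *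
    U))))) _ => //.
  by rewrite /U; lia.
apply: halts_seq; apply: halts_write => /=; set m0 := update _ _ _ _.
pose f s := cats (pk I) (fun=> [:: conv I s]).
apply: (@halts_for_const _ _ _ (pk I) _ (fun s m1 => [/\ agree L m m1,
  m1 22 0 = s * big I & dp I m1 (gs ++ cats s f) [::]])).
- move=> s m1 v [A E D1]; split; [exact: agree_update | by [] |].
  exact: dp_update.
- by move=> s m1 [A _ _] /=; rewrite A // (in_k HI).
- split=> //; first by apply: agree_update.
  by rewrite cats_nil cats0; apply: dp_update.
- move=> s m1 lts [A1 E1 D1] x1.
  apply: (@halts_time _ _ (7 + (pk I * (200 * U + (2 + 12)) + (2 + 12))));
    last first.
    apply: leq_trans (leq_add _ (loop_le (pk I) 14 _ (leqnn (200 * U)))) _ =>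
      //.
    by rewrite /U; lia.
  apply: halts_seq; apply: halts_write; rewrite [eval _ _]/= [eval _ _]/=.
  have A0 : agree dpvars m m1 by apply: agreeW A1.
  rewrite E1 (tb_big (tables_agree A0 HT)) addnC -mulSn.
  set m2 := update _ _ _ _.
  have A2 : agree L m m2 by apply: agree_update.
  have D2 : dp I m2 (gs ++ cats s f) [::] by apply: dp_update.
  apply: (@halts_for_dp_const I 23 _ _ _ _
       [:: 6; 10; 11; 12; 13; 14; 23] m2 (gs ++ cats s f)
       (fun=> [:: conv I s]) _ _ _ _ _ D2) => //.
  + by move=> m3 A /=; rewrite A // A2 // (in_k HI).
  + move=> r m3 gs3 Q3 ltr A3 x3 D3 HQ3.
    have A03 : agree dpvars m m3.
      by apply: agreeW (agree_step _ A2 A3).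
    have HI3 := input_agree A03 HI; have HT3 := tables_agree A03 HT.
    have x21 : m3 21 0 = s by rewrite A3 // -x1.
    have x22 : m3 22 0 = s.+1 * big I by rewrite A3.
    have V mv : mv \in conv I s -> valid I mv by apply: valid_conv.
    eapply halts_time.
      eapply halts_seq.
      eapply (halts_transfer (mv := (0, 0, top I)) (tb_top HT3) D3).
      - by apply: V; rewrite inE eqxx.
      - by move=> m4 A /=; rewrite !A // (tb_top HT3).
      move=> m4 A4 D4; eapply halts_seq.
      have T4 : m4 15 0 = top I by rewrite A4 // (tb_top HT3).
      eapply (halts_transfer (mv := (s.+1 * big I, wt I (pk I + s),
                              top I - s.+1 * big I)) T4 D4).
      - by apply: V; rewrite !inE eqxx orbT.
      - move=> m5 A /=; rewrite !A // !A4 // x21 x22 (in_k HI3) (tb_top HT3).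
        by split=> //; apply: (tb_wt HT3); rewrite ltn_add2l.
      move=> m5 A5 D5; have T5 : m5 15 0 = top I by rewrite A5.
      eapply (halts_advance T5 D5); first exact: V.
      move=> m6 A6 D6; apply: HQ3 => //.
      - by rewrite A6 // A5 // A4.
      - exact: agree_step (agree_step _ (agree_step _ A3 A4) A5) A6.
    by rewrite /= -/U; rewrite /U; lia.
  + move=> m3 A3 D3; split; first by rewrite A3.
    split; first exact: agree_step A2 A3.
      by rewrite A3.
    by rewrite catsS catA.
- by move=> m1 [A _ D1]; apply: HQ.
Qed.

Definition prog_vertices : cmd :=
  For 20 (Var 0)
    (If (Read 8 (Var 20)) Skip
      (Seq prog_edges (Seq prog_conv
      (Seq (transfer (Lit 0) (Lit 0) (Var 16)) advance)))).

Lemma halts_vertices I m gs (Q : memory -> Prop) :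
  (forall j, j < pk I -> px I j < pn I) ->
  input I m -> tables I m -> dp I m gs [::] ->
  (forall m', agree [:: 6; 10; 11; 12; 13; 14; 19; 20; 21; 22; 23] m m' ->
     dp I m' (gs ++ cats (pn I) (ops_vertex I)) [::] -> Q m') ->
  halts prog_vertices m
    (700 * ((pn I).+1 * ((pk I).+1 * ((pk I).+1 * (top I).+1)))) Q.
Proof.
move=> Hx HI HT D HQ; set U := (top I).+1.
pose L := [:: 6; 10; 11; 12; 13; 14; 19; 20; 21; 22; 23].
set V := (pk I).+1 * ((pk I).+1 * U).
have UV : (pk I).+1 * U <= V by rewrite leq_pmull.
have UU : U <= (pk I).+1 * U by rewrite leq_pmull.
apply: (@halts_time _ _ (pn I * (600 * V + (2 + 12)) + (2 + 12))); last first.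
  apply: leq_trans (loop_le (pn I) 14 _ (leqnn (600 * V))) _ => //.
  by rewrite leq_mul2r orbT.
apply: (@halts_for_dp_const I 20 _ _ _ _ L m gs (ops_vertex I) _ _ _ _ _ D) =>
  //.
  by move=> m1 A /=; rewrite A // (in_n HI).
move=> v m1 gs1 Q1 ltv A1 x1 D1 HQ1.
have A01 : agree dpvars m m1 by apply: agreeW A1.
have HI1 := input_agree A01 HI; have HT1 := tables_agree A01 HT.
apply: (@halts_time _ _ (3 + (214 * ((pk I).+1 * U) + (250 * V + (80 *
  U)))).+1); last first.
  have U0 : 0 < U by [].
  lia.
apply: halts_if; rewrite /= x1.
  rewrite (tb_cov HT1) // => cov.
  eapply halts_time; first eapply halts_skip; last by [].
  by apply: HQ1 => //; rewrite /ops_vertex cov cats0.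
move=> /eqP; rewrite -[_ == 0]negbK (tb_cov HT1) // => /negPf ncov.
eapply halts_seq; eapply (halts_edges Hx HI1 HT1 x1 ltv D1) => m2 A2 D2.
have A02 : agree dpvars m1 m2 by apply: agreeW A2.
have HI2 := input_agree A02 HI1; have HT2 := tables_agree A02 HT1.
eapply halts_seq; eapply (halts_conv HI2 HT2 D2) => m3 A3 D3.
have A03 : agree dpvars m2 m3 by apply: agreeW A3.
have HT3 := tables_agree A03 HT2.
have V3 : valid I (0, 0, big I).
  by move=> t /= ltt; rewrite !add0n; have := big_le_top I; lia.
eapply halts_time.
  eapply halts_seq; eapply (halts_transfer (tb_top HT3) D3 V3).
    by move=> m4 A /=; rewrite !A // (tb_big HT3).
  move=> m4 A4 D4; have T4 : m4 15 0 = top I by rewrite A4 // (tb_top HT3).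
  eapply (halts_advance T4 D4); first by move=> mv; rewrite inE => /eqP ->.
  move=> m5 A5 D5; apply: HQ1.
  - by rewrite A5 // A4 // A3 // A2.
  - exact: agree_step (agree_step _ (agree_step _ (agree_step _ A1 A2) A3) A4)
    A5.
  - by rewrite /ops_vertex ncov !catA; rewrite -!catA in D5 *.
by rewrite /= -/U; rewrite /U; lia.
Qed.

Definition prog_star : cmd :=
  Seq
    (For 19 (Var 4)
      (Seq (assign 26 (Lit 0))
      (Seq (For 25 (Read 2 (Var 18)) (assign 26 (Var 26 [+] Read 7 (Var 19))))
           (transfer (Var 26) (Lit 0) (Var 15 [-] Var 26)))))
  (Seq
    (If (Read 2 (Var 18) [-] Var 4) Skip
      (transfer (Read 7 (Var 4 [+] Read 2 (Var 18) [-] Lit 1)) (Lit 0)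
             (Var 15 [-] Read 7 (Var 4 [+] Read 2 (Var 18) [-] Lit 1))))
    advance).

Lemma halts_star I m gs i (Q : memory -> Prop) :
  input I m -> tables I m -> m 18 0 = i -> i < pd I ->
  0 < ps I i <= top I -> dp I m gs [::] ->
  (forall m', agree [:: 6; 10; 11; 12; 13; 14; 19; 25; 26] m m' ->
     dp I m' (gs ++ [:: star_shifts I (ps I i)]) [::] -> Q m') ->
  halts prog_star m (350 * ((pk I).+1 * (top I).+1)) Q.
Proof.
move=> HI HT x18 lti /andP[s_gt0 s_le] D HQ; set U := (top I).+1.
set s := ps I i in s_gt0 s_le HQ *.
have U0 : 0 < U by [].
have UU : U <= (pk I).+1 * U by rewrite leq_pmull.
pose L := [:: 6; 11; 12; 13; 14; 19; 25; 26].
apply: (@halts_time _ _ ((pk I * (200 * U + (2 + 12)) + (2 + 12)) +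
  ((6 + 90 * U).+1 + 7))); last first.
  have := loop_le (pk I) 14 U0 (leqnn (200 * U)); lia.
pose f j := [:: subm I (s * wt I j)].
apply: halts_seq.
apply: (@halts_for_const _ _ _ (pk I) _ (fun j m1 => agree L m m1 /\
  dp I m1 gs (cats j f))).
- move=> j m1 v [A D1]; split; first exact: agree_update.
  exact: dp_update.
- by move=> j m1 [A _] /=; rewrite A // (in_k HI).
- by rewrite cats_nil.
- move=> j m1 ltj [A1 D1] x1.
  apply: (@halts_time _ _ (3 + ((s * (8 + (3 + 12)) + (3 + 12)) + 90 * U)));
    last by rewrite /U; lia.
  apply: halts_seq; apply: halts_write; rewrite [eval _ _]/=.
  set m2 := update _ _ _ _.
  have A2 : agree L m m2 by apply: agree_update.
  have D2 : dp I m2 gs (cats j f) by apply: dp_update.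
  apply: halts_seq.
  apply: (@halts_for_const _ _ _ s _ (fun t m3 => [/\ agree [:: 25; 26] m2 m3,
     m3 26 0 = t * wt I j & dp I m3 gs (cats j f)])).
  + move=> t m3 v [A E D3]; split; [exact: agree_update | by [] |].
    exact: dp_update.
  + by move=> t m3 [A _ _] /=; rewrite !A // !A2 // x18 (in_s HI).
  + by split.
  + move=> t m3 ltt [A3 E3 D3] x3.
    have A03 : agree dpvars m m3 by apply: agreeW (agree_step _ A2 A3).
    apply: halts_write; split=> //; split.
    * exact: agree_update.
    * rewrite update_eq /= E3 [m3 19 0]A3 // {1}/m2 /update /= x1.
      rewrite (tb_wt (tables_agree A03 HT)) ?mulSn 1?addnC //.
      by rewrite ltn_addl.
    * exact: dp_update.
  move=> m3 [A3 E3 D3].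
  have A03 : agree dpvars m m3 by apply: agreeW (agree_step _ A2 A3).
  have T3 := tb_top (tables_agree A03 HT).
  eapply halts_time.
    eapply (halts_transfer (mv := subm I (s * wt I j)) T3 D3);
      first exact: valid_subm.
      by move=> m4 A /=; rewrite !A // E3 T3.
    move=> m4 A4 D4; split; first by rewrite A4 // A3.
    split; first exact: agree_step (agree_step _ A2 A3) A4.
    by rewrite catsS cats1.
  by rewrite /= -/U; rewrite /U; lia.
move=> m1 [A1 D1].
have A01 : agree dpvars m m1 by apply: agreeW A1.
have HI1 := input_agree A01 HI; have HT1 := tables_agree A01 HT.
have x1 : m1 18 0 = i by rewrite A1.
pose g := if s <= pk I then [:: subm I (wt I (pk I + s - 1))] else [::].
have V mv : mv \in star_shifts I s -> valid I mv.
  rewrite mem_cat => /orP[/flatten_mapP[j _]|].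
    by rewrite inE => /eqP ->; apply: valid_subm.
  by case: leqP; rewrite ?inE // => _ /eqP ->; apply: valid_subm.
apply: halts_seq; apply: (@halts_weak _ _ _ _ (fun m2 => agree L m m2 /\
    dp I m2 gs (star_shifts I s))); last first.
- move=> m2 [A2 D2].
  have T2 : m2 15 0 = top I by rewrite A2 // (tb_top HT).
  apply: (halts_advance T2 D2 V) => m3 A3 D3; apply: HQ D3.
  exact: agree_step (agreeW _ A2) A3.
- exact: leqnn.
apply: halts_if.
  rewrite /= x1 (in_s HI1) // (in_k HI1) -/s => ne.
  apply: (@halts_time _ _ 1) => //; apply: halts_skip; split=> //.
  have nle : (s <= pk I) = false by lia.
  by rewrite /star_shifts nle cats0.
rewrite /= x1 (in_s HI1) // (in_k HI1) -/s => /eqP; rewrite subn_eq0 => le.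
have E1 : m1 7 (pk I + s - 1) = wt I (pk I + s - 1).
  by apply: (tb_wt HT1); lia.
eapply halts_time.
  eapply (halts_transfer (mv := subm I (wt I (pk I + s - 1))) (tb_top HT1) D1).
  - exact: valid_subm.
  - move=> m2 A2 /=; rewrite !A2 // x1 (in_s HI1) // (in_k HI1) -/s E1.
    by rewrite (tb_top HT1).
  - move=> m2 A2 D2; split; first exact: agree_step A1 A2.
    by rewrite /star_shifts le cats1.
by rewrite /= -/U; rewrite /U; lia.
Qed.

Definition prog_stars : cmd :=
  For 18 (Read 0 (Lit 1)) (For 24 (Read 3 (Var 18)) prog_star).

Lemma halts_stars I m gs (Q : memory -> Prop) :
  (forall i, i < pd I -> 0 < ps I i <= top I) ->
  input I m -> tables I m -> dp I m gs [::] ->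
  (forall m', agree [:: 6; 10; 11; 12; 13; 14; 18; 19; 24; 25; 26] m m' ->
     dp I m' (gs ++ ops_stars I) [::] -> Q m') ->
  halts prog_stars m (400 * ((\sum_(i < pd I) (pa I i).+1).+1 *
    ((pk I).+1 * (top I).+1))) Q.
Proof.
move=> Hs HI HT D HQ; set U := (top I).+1; set V := (pk I).+1 * U.
have V0 : 0 < V by rewrite muln_gt0.
pose L := [:: 6; 10; 11; 12; 13; 14; 18; 19; 24; 25; 26].
apply: (@halts_time _ _ (\sum_(i < pd I) (365 * ((pa I i).+1 * V) + (2 + 12)) +
   (2 + 12))); last first.
  apply: (@leq_trans (400 * \sum_(i < pd I) ((pa I i).+1 * V) + 14)).
    rewrite leq_add2r big_distrr /=; apply: leq_sum => i _.
    suff : 1 <= (pa I i).+1 * V by lia.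
    by rewrite muln_gt0.
  by rewrite -big_distrl /= [(_.+1) * V]mulSn; lia.
apply: (@halts_for_dp I 18 _ _ (pd I) (fun i => 365 * ((pa I i).+1 * V))
  L m gs (fun i => cats (pa I i) (fun=> [:: star_shifts I (ps I i)]))) => //.
- by move=> m1 A /=; rewrite A // (in_d HI).
- move=> i m1 gs1 Q1 lti A1 x1 D1 HQ1.
  apply: (@halts_time _ _ (pa I i * (350 * V + (3 + 12)) + (3 + 12)));
    last first.
    by apply: leq_trans (loop_le (pa I i) 15 _ (leqnn (350 * V))) _.
  pose L1 := [:: 6; 10; 11; 12; 13; 14; 19; 24; 25; 26].
  apply: (@halts_for_dp_const I 24 _ _ _ _ L1 m1 gs1
     (fun=> [:: star_shifts I (ps I i)]) _ _ _ _ _ D1) => //.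
  + by move=> m2 A /=; rewrite !A // x1 A1 // (in_a HI).
  + move=> q m2 gs2 Q2 ltq A2 x2 D2 HQ2.
    have A02 : agree dpvars m m2 by apply: agreeW (agree_step _ A1 A2).
    have HI2 := input_agree A02 HI; have HT2 := tables_agree A02 HT.
    have x18 : m2 18 0 = i by rewrite A2.
    apply: (halts_star HI2 HT2 x18 lti (Hs _ lti) D2) => m3 A3 D3.
    apply: HQ2 => //; first by rewrite A3.
    exact: agree_step A2 A3.
  + move=> m2 A2 D2; apply: HQ1 => //; first by rewrite A2.
    exact: agree_step A1 A2.
Qed.

(* The machine has no multiplication. *)
Definition times (x y : nat) (e ea : expr) : cmd :=
  For x e (assign y (Var y [+] ea)).

Lemma halts_times x y e ea N a (m : memory) (Q : memory -> Prop) :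
  x != y ->
  (forall m', agree [:: x; y] m m' -> eval m' e = N) ->
  (forall m', agree [:: x; y] m m' -> eval m' ea = a) ->
  (forall m', agree [:: x; y] m m' -> m' y 0 = m y 0 + N * a -> Q m') ->
  halts (times x y e ea) m
     (N * ((ecost ea + 5) + (ecost e + 12)) + (ecost e + 12)) Q.
Proof.
move=> xy He Ha HQ.
apply: (@halts_for_const _ _ _ N _ (fun t m1 => agree [:: x; y] m m1 /\
   m1 y 0 = m y 0 + t * a)).
- move=> t m1 v [A E]; split; first by apply: agree_update; rewrite ?inE ?eqxx.
  by rewrite /update eq_sym (negPf xy).
- by move=> t m1 [A _]; apply: He.
- by rewrite addn0.
- move=> t m1 ltt [A E] x1; eapply halts_time.
    eapply halts_write; split; first by rewrite /update (negPf xy).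
    split; first by apply: agree_update; rewrite ?inE ?eqxx ?orbT.
    by rewrite update_eq /= E (Ha _ A) mulSn addnCA addnC addnA.
  by rewrite /=; lia.
- by move=> m1 [A E]; apply: HQ.
Qed.

Definition prog_base : cmd :=
  Seq (assign 17 (Lit 1)) (times 18 17 (Var 0) (Var 0 [+] Var 0)).

Lemma halts_base I m (Q : memory -> Prop) :
  input I m ->
  (forall m', agree [:: 17; 18] m m' -> m' 17 0 = base I -> Q m') ->
  halts prog_base m (50 * (pn I).+1) Q.
Proof.
move=> HI HQ; eapply halts_time.
  eapply halts_seq; eapply halts_write.
  eapply (@halts_times 18 17 _ _ (pn I) (pn I + pn I)) => //.
  - by move=> m1 A /=; rewrite A // /update /= (in_n HI).
  - by move=> m1 A /=; rewrite A // /update /= (in_n HI).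
  - move=> m1 A E; apply: HQ; last by rewrite E update_eq add1n.
    apply: (agree_step (l := [:: 18; 17])) A => //.
    exact: agree_update.
by rewrite /=; lia.
Qed.

Definition prog_powers : cmd :=
  Seq (assign 16 (Lit 1))
  (For 19 (Var 4 [+] Var 4)
    (Seq (Write 7 (Var 19) (Var 16))
    (Seq (assign 26 (Lit 0))
    (Seq (times 25 26 (Var 17) (Var 16))
         (assign 16 (Var 26)))))).

Lemma halts_powers I m (Q : memory -> Prop) :
  input I m -> m 17 0 = base I ->
  (forall m', agree [:: 7; 16; 19; 25; 26] m m' -> m' 16 0 = big I ->
     (forall j, j < pk I + pk I -> m' 7 j = wt I j) -> Q m') ->
  halts prog_powers m (70 * ((pk I + pk I).+1 * (base I).+1)) Q.
Proof.
move=> HI EB HQ; set U := (base I).+1.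
pose L := [:: 7; 16; 19; 25; 26].
apply: (@halts_time _ _ (3 + ((pk I + pk I) * (50 * U + (5 + 12)) + (5 + 12)))).
  apply: halts_seq; apply: halts_write.
  apply: (@halts_for_const _ _ _ (pk I + pk I) _ (fun j m1 =>
    [/\ agree L m m1, m1 16 0 = wt I j
      & forall j', j' < j -> m1 7 j' = wt I j'])).
  - by move=> j m1 v [A E W]; split=> //; apply: agree_update.
  - by move=> j m1 [A _ _] /=; rewrite !A // (in_k HI).
  - by split=> //; apply: agree_update.
  - move=> j m1 ltj [A1 E1 W1] x1.
    eapply halts_time.
      eapply halts_seq; eapply halts_write; rewrite /= x1 E1;
        set m2 := update _ _ _ _.
      have A2 : agree L m m2 by apply: agree_update.
      eapply halts_seq; eapply halts_write; set m3 := update _ _ _ _.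
      have A3 : agree L m m3 by apply: agree_update.
      have E3 : m3 16 0 = wt I j by rewrite /m3 /m2 /update.
      eapply halts_seq; eapply (@halts_times 25 26 _ _ (base I) (wt I j)) => //.
      + by move=> m4 A4 /=; rewrite A4 // A3.
      + by move=> m4 A4 /=; rewrite A4.
      move=> m4 A4; rewrite [m3 26 0]update_eq add0n => E4.
      eapply halts_write; rewrite /= E4 -/(wt I j); split.
        by rewrite /update /= A4.
      split; first by apply: agree_update => //; apply: agree_step A4.
        by rewrite update_eq /wt expnS.
      move=> j'; rewrite ltnS leq_eqVlt /update /= A4 // /m3 /m2 /update /=.
      by case: eqP => [->|_ /W1].
    by rewrite /= /U; lia.
  - by move=> m1 [A E W]; apply: HQ.
have := loop_le (pk I + pk I) 17 (ltn0Sn (base I)) (leqnn (50 * U)).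
by rewrite -/U; have : 0 < (pk I + pk I).+1 * U by []; lia.
Qed.

Definition prog_top : cmd :=
  Seq (assign 15 (Lit 0)) (times 18 15 (Var 4 [+] Lit 1) (Var 16)).

Lemma halts_top I m (Q : memory -> Prop) :
  input I m -> m 16 0 = big I ->
  (forall m', agree [:: 15; 18] m m' -> m' 15 0 = top I -> Q m') ->
  halts prog_top m (60 * (pk I).+1) Q.
Proof.
move=> HI ER HQ; eapply halts_time.
  eapply halts_seq; eapply halts_write.
  eapply (@halts_times 18 15 _ _ (pk I).+1 (big I)) => //.
  - by move=> m1 A /=; rewrite A // /update /= (in_k HI) addn1.
  - by move=> m1 A /=; rewrite A // /update /=.
  - move=> m1 A E; apply: HQ; last by rewrite E update_eq.
    apply: (agree_step (l := [:: 18; 15])) A => //.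
    exact: agree_update.
by rewrite /=; lia.
Qed.

Definition prog_rows : cmd :=
  Seq (assign 26 (Lit 0))
  (For 18 (Var 0)
    (Seq (Write 9 (Var 18) (Var 26)) (assign 26 (Var 26 [+] Var 0)))).

Lemma halts_rows I m (Q : memory -> Prop) :
  input I m ->
  (forall m', agree [:: 9; 18; 26] m m' ->
     (forall v, v < pn I -> m' 9 v = v * pn I) -> Q m') ->
  halts prog_rows m (40 * (pn I).+1) Q.
Proof.
move=> HI HQ; pose L := [:: 9; 18; 26].
apply: (@halts_time _ _ (3 + (pn I * (13 + (2 + 12)) + (2 + 12)))); last by lia.
apply: halts_seq; apply: halts_write.
apply: (@halts_for_const _ _ _ (pn I) _ (fun v m1 =>
  [/\ agree L m m1, m1 26 0 = v * pn I
    & forall v', v' < v -> m1 9 v' = v' * pn I])).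
- by move=> v m1 w [A E W]; split=> //; apply: agree_update.
- by move=> v m1 [A _ _] /=; rewrite !A // (in_n HI).
- by split=> //; apply: agree_update.
- move=> v m1 ltv [A1 E1 W1] x1.
  apply: (@halts_time _ _ (5 + 7)); last by [].
  apply: halts_seq; apply: halts_write; rewrite /= x1 E1;
    set m2 := update _ _ _ _.
  have A2 : agree L m m2 by apply: agree_update.
  apply: halts_write; split; first by rewrite /update /= /m2 /update.
  split; first exact: agree_update.
    by rewrite update_eq /= [m2 26 0]E1 A2 // (in_n HI) mulSn addnC.
  move=> v'; rewrite ltnS leq_eqVlt /update /= /m2 /update /=.
  by case: eqP => [->|_ /W1].
- by move=> m1 [A E W]; apply: HQ.
Qed.

Definition prog_marks : cmd :=
  For 18 (Var 4) (Write 8 (Read 5 (Var 18)) (Lit 1)).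

Lemma halts_marks I m (Q : memory -> Prop) :
  input I m -> (forall v, m 8 v = 0) ->
  (forall m', agree [:: 8; 18] m m' ->
     (forall v, (m' 8 v != 0) = covered I v) -> Q m') ->
  halts prog_marks m (40 * (pk I).+1) Q.
Proof.
move=> HI Z HQ.
apply: (@halts_time _ _ (pk I * (5 + (2 + 12)) + (2 + 12))); last by lia.
apply: (@halts_for_const _ _ _ (pk I) _ (fun j m1 => agree [:: 8; 18] m m1 /\
  forall v, (m1 8 v != 0) = (v \in [seq px I i | i <- iota 0 j]))).
- move=> j m1 v [A W]; split=> //; exact: agree_update.
- by move=> j m1 [A _] /=; rewrite !A // (in_k HI).
- by split=> // v; rewrite Z.
- move=> j m1 ltj [A1 W1] x1.
  apply: halts_write; split=> //; split; first exact: agree_update.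
  move=> v; rewrite -[j.+1]addn1 iotaD map_cat mem_cat -W1.
  rewrite /= inE x1 A1 // (in_x HI) // /update /=.
  by rewrite add0n; case: (v == _); rewrite ?orbT ?orbF.
- by move=> m1 [A W]; apply: HQ.
Qed.

Definition prog_setup : cmd :=
  Seq prog_base (Seq prog_powers (Seq prog_top (Seq prog_rows (Seq prog_marks
  (Seq (assign 10 (Lit 0)) (assign 6 (Lit 1))))))).

Lemma input_agree_high l I m m' :
  agree l m m' -> all (fun b => 5 < b) l -> input I m -> input I m'.
Proof.
move=> A /allP lb [h1 h2 h3 h4 h5 h6 h7].
have nl b : b <= 5 -> b \notin l.
  by move=> le; apply/negP => /lb; rewrite ltnNge le.
by split=> *; rewrite A ?nl //; do ?[exact: h3 | exact: h4 | exact: h5 | exact: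
  h7].
Qed.

Lemma halts_setup I m (Q : memory -> Prop) :
  input I m -> (forall i, m 6 i = 0) -> (forall i, m 8 i = 0) ->
  (forall m', input I m' -> tables I m' -> dp I m' [::] [::] -> Q m') ->
  halts prog_setup m (90 * (pn I).+1 + 70 * ((pk I + pk I).+1 * (base I).+1)
    + 110 * (pk I).+1) Q.
Proof.
move=> HI0 Z6 Z8 HQ; eapply halts_time.
  eapply halts_seq; eapply (halts_base HI0) => m1 A1 E1.
  have HI1 := input_agree_high A1 isT HI0.
  eapply halts_seq; eapply (halts_powers HI1 E1) => m2 A2 R2 W2.
  have HI2 := input_agree_high A2 isT HI1.
  eapply halts_seq; eapply (halts_top HI2 R2) => m3 A3 T3.
  have HI3 := input_agree_high A3 isT HI2.
  eapply halts_seq; eapply (halts_rows HI3) => m4 A4 R4.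
  have HI4 := input_agree_high A4 isT HI3.
  eapply halts_seq; eapply (halts_marks HI4).
    by move=> v; rewrite A4 // A3 // A2 // A1.
  move=> m5 A5 C5; have HI5 := input_agree_high A5 isT HI4.
  eapply halts_seq; eapply halts_write; eapply halts_write.
  set m7 := update _ _ _ _.
  have A7 : agree [:: 6; 10] m5 m7 by do 2!apply: agree_update => //.
  apply: HQ.
  - exact: input_agree_high A7 isT HI5.
  - split.
    + by move=> j ltj; rewrite A7 // A5 // A4 // A3 // W2.
    + by move=> v _; rewrite A7 // C5.
    + by move=> v ltv; rewrite A7 // A5 // R4.
    + by rewrite A7 // A5 // A4 // T3.
    + by rewrite A7 // A5 // A4 // A3 // R2.
  - have E10 : m7 10 0 = 0 by [].
    have top_gt0 : 0 < top I by rewrite /top /big muln_gt0 wt_gt0.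
    have E6 c : (m7 6 c != 0) = (c == 0).
      rewrite /m7 /update /=; case: (c =P 0) => // _.
      by rewrite A5 // A4 // A3 // A2 // A1 // Z6.
    split=> c; rewrite E10 E6 !add0n.
      by move=> _; split=> [/eqP ->|<-].
    split; first by lia.
    by case=> c0 _ [mv].
by rewrite /=; lia.
Qed.

Definition prog_main : cmd :=
  If (Var 4)
    (Seq prog_setup (Seq prog_cover (Seq prog_vertices (Seq prog_stars
      (If (Read 6 (Var 10)) (assign 0 (Lit 1)) (assign 0 (Lit 0)))))))
    (assign 0 (Lit 1)).

Lemma halts_main I m :
  0 < pk I ->
  (forall j, j < pk I -> px I j < pn I) ->
  (forall i, i < pd I -> 0 < ps I i <= top I) ->
  input I m -> (forall i, m 6 i = 0) -> (forall i, m 8 i = 0) ->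
  halts prog_main m
    (2000 * (((pn I).+1 + (\sum_(i < pd I) (pa I i).+1).+1) *
             ((pk I).+1 * ((pk I).+1 * (top I).+1))))
    (fun m' => (m' 0 0 = 1 /\ reach (ops I) 0 0) \/
               (m' 0 0 = 0 /\ ~ reach (ops I) 0 0)).
Proof.
move=> k0 Hx Hs HI Z6 Z8; eapply halts_time.
  eapply halts_if; last by rewrite /= (in_k HI); lia.
  move=> _; eapply halts_seq; eapply (halts_setup HI Z6 Z8) => m1 HI1 HT1 D1.
  eapply halts_seq; eapply (halts_cover Hx HI1 HT1 D1) => m2 A2 D2.
  have A12 : agree dpvars m1 m2 by apply: agreeW A2.
  have HI2 := input_agree A12 HI1; have HT2 := tables_agree A12 HT1.
  eapply halts_seq; eapply (halts_vertices Hx HI2 HT2 D2) => m3 A3 D3.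
  have A23 : agree dpvars m2 m3 by apply: agreeW A3.
  have HI3 := input_agree A23 HI2; have HT3 := tables_agree A23 HT2.
  eapply halts_seq; eapply (halts_stars Hs HI3 HT3 D3) => m4 A4 D4.
  have top_gt0 : 0 < top I by rewrite /top /big muln_gt0 wt_gt0.
  have R : m4 6 (m4 10 0) != 0 <-> reach (ops I) 0 0.
    case: D4 => D4 _; have := D4 0 top_gt0.
    by rewrite addn0 /ops catA.
  apply: (@halts_time _ _ (3 + 3).+1); last exact: leqnn.
  apply: halts_if => /= [nz|z].
    by apply: halts_write; left; split=> //; apply/R.
  apply: halts_write; right; split=> // /R; by rewrite z.
rewrite /=.
set a := (\sum_(i < _) _).+1; set n1 := (pn I).+1; set k1 := (pk I).+1.
set U := (top I).+1.
have leU : (base I).+1 <= U.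
  rewrite ltnS; apply: leq_trans (big_le_top I).
  rewrite -[base I]expn1; apply: (leq_trans _ (@wt_le_big I 1 _)) => //.
  by rewrite (leq_trans k0) ?leq_addr.
have le2 : (pk I + pk I).+1 * (base I).+1 <= 2 * (k1 * U).
  by rewrite mulnA; apply: leq_mul => //; rewrite /k1; lia.
have U0 : 0 < U by [].
have kU : k1 * U <= k1 * (k1 * U) by rewrite leq_pmull.
have k1V : k1 <= k1 * U by rewrite leq_pmulr.
rewrite mulnDl.
have aV : a * (k1 * U) <= a * (k1 * (k1 * U)) by rewrite leq_mul2l kU orbT.
move: kU k1V aV le2; rewrite -/k1 -/n1 -/U -/a; set V := k1 * (k1 * U).
move=> kU k1V aV le2.
have V0 : 0 < V by rewrite !muln_gt0.
have n1V : n1 <= n1 * V by rewrite leq_pmulr.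
have V1 : V <= n1 * V by rewrite leq_pmull.
move: (n1 * V) (a * V) (a * (k1 * U)) (k1 * U) ((_ + _).+1 * _) aV le2 kU k1V
  n1V V1 V0 => *.
lia.
Qed.

(** * Reachable states *)

Lemma divmod_uniq D q q' r r' :
  r < D -> r' < D -> q * D + r = q' * D + r' -> q = q' /\ r = r'.
Proof.
move=> ltr ltr' E; have D0 : 0 < D by lia.
have := congr1 (fun x => (x %/ D, x %% D)) E.
by rewrite !modnMDl !divnMDl // !(divn_small ltr, divn_small ltr') !addn0
  !modn_small // => -[].
Qed.

Lemma digits_lt B N (u : nat -> nat) :
  (forall l, l < N -> u l < B) -> \sum_(l < N) u l * B ^ l < B ^ N.
Proof.
elim: N => [|N IH] lt; first by rewrite big_ord0 expn0.
rewrite big_ord_recr /= expnS.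
apply: (@leq_trans (B ^ N + u N * B ^ N)).
  by rewrite ltn_add2r; apply: IH => l /ltnW /lt.
by rewrite -mulSn leq_mul2r lt ?orbT.
Qed.

Lemma digits_inj B N (u u' : nat -> nat) :
  (forall l, l < N -> u l < B) -> (forall l, l < N -> u' l < B) ->
  \sum_(l < N) u l * B ^ l = \sum_(l < N) u' l * B ^ l ->
  forall l, l < N -> u l = u' l.
Proof.
elim: N => [//|N IH] lt lt'; rewrite !big_ord_recr /= => E l.
have ltN := fun l (ll : l < N) => lt l (ltnW ll).
have ltN' := fun l (ll : l < N) => lt' l (ltnW ll).
have [EN E'] : u N = u' N /\
    \sum_(l < N) u l * B ^ l = \sum_(l < N) u' l * B ^ l.
  apply: (@divmod_uniq (B ^ N)); try exact: digits_lt.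
  by rewrite addnC E addnC.
by rewrite ltnS leq_eqVlt => /orP[/eqP ->|/(IH ltN ltN' E')].
Qed.

Lemma cats_sound (C : Type) (x0 : C) (P : nat -> C -> Prop)
    (w o : nat -> C -> nat) (J : nat -> nat -> Prop) N f c c' :
  (forall i c c1, i < N -> J i c -> reach (f i) c c1 ->
     J i.+1 c1 /\ exists x, P i x /\ c1 + o i x = c + w i x) ->
  J 0 c -> reach (cats N f) c c' ->
  J N c' /\ exists ch : nat -> C, (forall i, i < N -> P i (ch i)) /\
    c' + \sum_(i < N) o i (ch i) = c + \sum_(i < N) w i (ch i).
Proof.
move=> step J0; elim: N c' step => [|N IH] c' step.
  rewrite cats_nil /= => E; subst c'; split=> //; exists (fun=> x0).
  by rewrite !big_ord0.
rewrite catsS => /reach_cat[c1 r1 r2].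
have [JN [ch [Pch Ech]]] := IH _ (fun i c c1 lt => step i c c1 (ltnW lt)) r1.
have [JS [x [Px Ex]]] := step _ _ _ (ltnSn N) JN r2.
split=> //; exists (fun i => if i == N then x else ch i); split.
  move=> i; rewrite ltnS leq_eqVlt.
  by case: (eqVneq i N) => [->|_ /Pch].
rewrite !big_ord_recr /= eqxx.
rewrite (eq_bigr (fun i : 'I_N => o i (ch i))); last first.
  by move=> i _; rewrite ltn_eqF.
rewrite [in RHS](eq_bigr (fun i : 'I_N => w i (ch i))); last first.
  by move=> i _; rewrite ltn_eqF.
by rewrite addnCA Ex addnA [_ + c1]addnC Ech addnA.
Qed.

Lemma cats_sound_T (C : Type) (x0 : C) (P : nat -> C -> Prop)
    (w o : nat -> C -> nat) N f c c' :
  (forall i c c1, i < N -> reach (f i) c c1 ->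
     exists x, P i x /\ c1 + o i x = c + w i x) ->
  reach (cats N f) c c' ->
  exists ch : nat -> C, (forall i, i < N -> P i (ch i)) /\
    c' + \sum_(i < N) o i (ch i) = c + \sum_(i < N) w i (ch i).
Proof.
move=> step r.
have [//|_ //] := @cats_sound C x0 P w o (fun _ _ => True) N f c c' _ I r.
by move=> i c0 c1 lti _ /(step _ _ _ lti).
Qed.

Lemma partial_sum_le (F : nat -> nat) i N :
  i <= N -> \sum_(j < i) F j <= \sum_(j < N) F j.
Proof.
move=> le; rewrite (big_ord_widen N F le) big_mkcond /=.
by apply: leq_sum => l _; case: ifP.
Qed.

Lemma cats_path N f (y : nat -> nat) :
  (forall i, i < N -> reach (f i) (y i) (y i.+1)) ->
  reach (cats N f) (y 0) (y N).
Proof.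
elim: N => [//|N IH] step; rewrite catsS; apply/reach_cat.
exists (y N); first by apply: IH => i lti; apply: step; apply: ltnW.
exact: step.
Qed.

Lemma cats_add_path N f (w : nat -> nat) c M :
  c + \sum_(i < N) w i < M ->
  (forall i c', i < N -> c' + w i < M -> reach (f i) c' (c' + w i)) ->
  reach (cats N f) c (c + \sum_(i < N) w i).
Proof.
move=> lt step.
have := @cats_path N f (fun i => c + \sum_(i' < i) w i').
rewrite big_ord0 addn0; apply=> i lti.
rewrite big_ord_recr /= addnA; apply: step => //.
apply: leq_ltn_trans lt; rewrite -addnA leq_add2l.
by have := partial_sum_le w lti; rewrite big_ord_recr.
Qed.

Lemma reach1 g c c' : reach [:: g] c c' <-> gstep g c c'.
Proof. by split=> [[c1 s <-]|s] //; exists c'. Qed.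

Lemma shifts_addm I w c c' : shifts (addm I w) c c' -> c' = c + w.
Proof. by move=> [t /= [_ -> ->]]; lia. Qed.

Lemma shifts_addm_ex I w c : c + w < top I -> shifts (addm I w) c (c + w).
Proof. by move=> lt; exists c => /=; split; lia. Qed.

Lemma shifts_subm I w c c' : shifts (subm I w) c c' -> c' + w = c.
Proof. by move=> [t /= [_ -> ->]]; lia. Qed.

Lemma shifts_subm_ex I w c : c + w < top I -> shifts (subm I w) (c + w) c.
Proof. by move=> lt; exists c => /=; split; lia. Qed.

Lemma gstep_addm2 I w1 w2 c c' :
  gstep [:: addm I w1; addm I w2] c c' ->
  exists x : bool, c' = c + (if x then w1 else w2).
Proof.
by move=> [mv]; rewrite !inE => /orP[] /eqP -> /shifts_addm ->;
  [exists true | exists false].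
Qed.

Lemma gstep_addm2_ex I w1 w2 c (x : bool) :
  c + (if x then w1 else w2) < top I ->
  gstep [:: addm I w1; addm I w2] c (c + (if x then w1 else w2)).
Proof.
case: x => lt.
  by exists (addm I w1); [rewrite inE eqxx | apply: shifts_addm_ex].
by exists (addm I w2); [rewrite !inE eqxx orbT | apply: shifts_addm_ex].
Qed.

Definition cover_sum (I : inst) (e : nat -> nat -> bool) : nat :=
  \sum_(i < pk I) \sum_(j < i)
    padj I (px I i) (px I j) * (if e i j then wt I i else wt I j).

Lemma cover_sound I c c' :
  reach (ops_cover I) c c' -> exists e, c' = c + cover_sum I e.
Proof.
move=> /(cats_sound_T (C := nat -> bool) (fun=> false) (P := fun _ _ => True)
  (w := fun i e => \sum_(j < i)
     padj I (px I i) (px I j) * (if e j then wt I i else wt I j))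
  (o := fun _ _ => 0)) [|e [_]]; last first.
  by rewrite big1 // addn0 => ->; exists e.
move=> i {}c c1 lti.
move=> /(cats_sound_T (C := bool) false (P := fun _ _ => True)
  (w := fun j e =>
     padj I (px I i) (px I j) * (if e then wt I i else wt I j))
  (o := fun _ _ => 0)) [|e [_ E]]; last first.
  by exists e; split=> //; move: E; rewrite big1.
move=> j {}c {}c1 ltj; rewrite /ops_pair.
case: (padj _ _ _) => [/reach1 /gstep_addm2[x ->]|<-].
  by exists x; rewrite mul1n addn0.
by exists true.
Qed.

Lemma cover_complete I c e :
  c + cover_sum I e < top I -> reach (ops_cover I) c (c + cover_sum I e).
Proof.
move=> lt; apply: (cats_add_path (w := fun i => \sum_(j < i)
  padj I (px I i) (px I j) * (if e i j then wt I i else wt I j)) lt).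
move=> i {lt}c lti lt.
apply: (cats_add_path (w := fun j => padj I (px I i) (px I j) *
  (if e i j then wt I i else wt I j)) lt) => j {lt}c ltj.
rewrite /ops_pair; case: (padj _ _ _) => lt; last by rewrite mul0n addn0.
by apply/reach1; rewrite mul1n in lt *; apply: gstep_addm2_ex.
Qed.

Definition out_deg (I : inst) (v : nat) (om : nat -> bool) : nat :=
  \sum_(j < pk I) (padj I v (px I j) && ~~ om j).

Definition in_sum (I : inst) (v : nat) (om : nat -> bool) : nat :=
  \sum_(j < pk I) (padj I v (px I j) && om j) * wt I j.

Definition part_sum (I : inst) (p : nat -> nat) : nat :=
  \sum_(s < pk I) p s * wt I (pk I + s).

Definition part_size (I : inst) (p : nat -> nat) : nat :=
  \sum_(s < pk I) s.+1 * p s.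

Lemma in_out_sum I v (om : nat -> bool) :
  \sum_(j < pk I) padj I v (px I j) * (if om j then wt I j else big I)
  = in_sum I v om + out_deg I v om * big I.
Proof.
rewrite /in_sum /out_deg big_distrl -big_split /=; apply: eq_bigr => j _.
by case: (padj _ _ _) (om j) => -[]; rewrite ?mul0n ?mul1n ?addn0.
Qed.

Lemma edges_sound I v c c' :
  reach (ops_edges I v) c c' ->
  exists om, c' = c + (in_sum I v om + out_deg I v om * big I).
Proof.
move=> /(cats_sound_T (C := bool) false (P := fun _ _ => True)
  (w := fun j x => padj I v (px I j) * (if x then wt I j else big I))
  (o := fun _ _ => 0)) [|om [_ E]]; last first.
  by exists om; move: E; rewrite big1 // addn0 -in_out_sum.
move=> j {}c {}c1 ltj; rewrite /ops_edge.
case: (padj _ _ _) => [/reach1 /gstep_addm2[x ->]|<-].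
  by exists x; rewrite mul1n addn0.
by exists true.
Qed.

Lemma edges_complete I v om c :
  c + (in_sum I v om + out_deg I v om * big I) < top I ->
  reach (ops_edges I v) c (c + (in_sum I v om + out_deg I v om * big I)).
Proof.
rewrite -in_out_sum => lt.
apply: (cats_add_path (w := fun j => padj I v (px I j) *
  (if om j then wt I j else big I)) lt) => j {lt}c ltj.
rewrite /ops_edge; case: (padj _ _ _) => lt; last by rewrite mul0n addn0.
by apply/reach1; rewrite mul1n in lt *; apply: gstep_addm2_ex.
Qed.

Lemma gstep_conv I s c c' :
  gstep (conv I s) c c' ->
  exists x : bool,
    c' + x * (s.+1 * big I) = c + x * wt I (pk I + s).
Proof.
move=> [mv]; rewrite !inE => /orP[] /eqP -> [t /= [_ -> ->]].
  by exists false.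
by exists true; rewrite !mul1n; lia.
Qed.

Lemma convs_sound I s N c c' :
  reach (cats N (fun=> [:: conv I s])) c c' ->
  exists2 p, p <= N & c' + p * (s.+1 * big I) = c + p * wt I (pk I + s).
Proof.
move=> /(cats_sound_T (C := bool) false (P := fun _ _ => True)
  (w := fun _ (x : bool) => x * wt I (pk I + s))
  (o := fun _ (x : bool) => x * (s.+1 * big I))) [|h [_]]; last first.
  rewrite -!big_distrl /= => E; exists (\sum_(i < N) h i) => //.
  by rewrite -[leqRHS]muln1 -[X in X * 1]card_ord -sum_nat_const leq_sum // =>
    i _; case: (h i).
by move=> i {}c {}c1 _ /reach1 /gstep_conv[x]; exists x.
Qed.

Lemma conv_sound I c c' :
  reach (ops_conv I) c c' ->
  exists p : nat -> nat, (forall s, s < pk I -> p s <= pk I) /\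
    c' + part_size I p * big I = c + part_sum I p.
Proof.
move=> /(cats_sound_T (C := nat) 0 (P := fun _ q => q <= pk I)
  (w := fun s q => q * wt I (pk I + s))
  (o := fun s q => q * (s.+1 * big I))) [|p [lep E]]; last first.
  exists p; split=> //; rewrite -[RHS]E /part_size big_distrl /=.
  by congr (_ + _); apply: eq_bigr => s _; rewrite mulnA [p s * _]mulnC.
by move=> s {}c {}c1 _ /convs_sound[q]; exists q.
Qed.

Lemma conv_step I s c :
  s < pk I -> c + s.+1 * big I < top I ->
  gstep (conv I s) (c + s.+1 * big I) (c + wt I (pk I + s)).
Proof.
move=> lts lt.
exists (s.+1 * big I, wt I (pk I + s), top I - s.+1 * big I).
  by rewrite !inE eqxx orbT.
by exists c; split=> /=; lia.
Qed.

Lemma conv_stay I s c : c < top I -> gstep (conv I s) c c.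
Proof. by move=> lt; exists (0, 0, top I); [rewrite inE eqxx|exists c]. Qed.

Lemma convs_complete I s N (p c : nat) :
  s < pk I -> p <= N -> c + p * (s.+1 * big I) < top I ->
  reach (cats N (fun=> [:: conv I s])) (c + p * (s.+1 * big I))
    (c + p * wt I (pk I + s)).
Proof.
move=> lts; have leW : wt I (pk I + s) <= s.+1 * big I.
  by rewrite mulSn (leq_trans (@wt_le_big I _ _)) ?leq_addr //; lia.
have step y : y + s.+1 * big I < top I ->
    gstep (conv I s) (y + s.+1 * big I) (y + wt I (pk I + s)).
  exact: conv_step.
move: (s.+1 * big I) (wt I (pk I + s)) leW step => D W leW step.
elim: N p c => [|N IH] p c.
  by rewrite leqn0 => /eqP -> _; rewrite cats_nil !mul0n.
rewrite leq_eqVlt => /orP[/eqP -> lt|ltp lt]; rewrite catsS; apply/reach_cat.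
  exists (c + D + N * W).
    by rewrite mulSn addnA; apply: IH => //; rewrite -addnA -mulSn.
  apply/reach1; rewrite mulSn [W + _]addnC addnA addnAC; apply: step.
  apply: leq_ltn_trans lt; rewrite mulSn [D + _]addnC addnA leq_add2r leq_add2l.
  by rewrite leq_mul2l leW orbT.
exists (c + p * W); first exact: IH.
apply/reach1; apply: conv_stay; apply: leq_ltn_trans lt.
by rewrite leq_add2l leq_mul2l leW orbT.
Qed.

Lemma conv_complete I (p : nat -> nat) c :
  (forall s, s < pk I -> p s <= pk I) ->
  c + part_sum I p < big I -> part_size I p <= pk I ->
  reach (ops_conv I) (c + part_size I p * big I) (c + part_sum I p).
Proof.
move=> lep ltc les.
pose y s := c + \sum_(s' < s) p s' * wt I (pk I + s') +
  \sum_(s' < pk I | s <= s') s'.+1 * p s' * big I.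
have -> : c + part_size I p * big I = y 0.
  by rewrite /y big_ord0 addn0 /part_size big_distrl.
have -> : c + part_sum I p = y (pk I).
  rewrite /y [X in _ + _ + X]big1 ?addn0 // => s.
  by rewrite leqNgt ltn_ord.
apply: cats_path => s lts.
pose z := c + \sum_(s' < s) p s' * wt I (pk I + s') +
  \sum_(s' < pk I | s < s') s'.+1 * p s' * big I.
have E1 : y s = z + p s * (s.+1 * big I).
  rewrite /y /z (bigD1 (Ordinal lts)) //= -!addnA; congr (_ + (_ + _)).
  rewrite addnC [s.+1 * _]mulnC mulnA; congr (_ + _).
  by apply: eq_bigl => i; rewrite ltn_neqAle andbC eq_sym.
have E2 : y s.+1 = z + p s * wt I (pk I + s).
  by rewrite /y /z big_ord_recr /= -!addnA; congr (_ + (_ + _)); rewrite addnC.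
rewrite E1 E2; apply: convs_complete => //; first exact: lep.
rewrite -E1 /y; apply: (@leq_trans (big I + part_size I p * big I)).
  apply: (@leq_ltn_trans (c + part_sum I p + part_size I p * big I)).
    rewrite -!addnA leq_add2l leq_add //.
      exact: (partial_sum_le (fun s => p s * wt I (pk I + s)) (ltnW lts)).
    rewrite /part_size big_distrl /= big_mkcond /=.
    by apply: leq_sum => i _; case: ifP.
  by rewrite ltn_add2r.
by rewrite -mulSn leq_mul2r ltnS les orbT.
Qed.

Definition low (I : inst) (v : nat) (om : nat -> bool) (p : nat -> nat) : nat :=
  in_sum I v om + part_sum I p.

Definition split_ok (I : inst) (v : nat) (om : nat -> bool) (p : nat -> nat) :
    Prop :=
  (forall s, s < pk I -> p s <= pk I) /\ part_size I p = out_deg I v om.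

Definition ones (I : inst) : nat := \sum_(l < pk I + pk I) wt I l.

Lemma low_le I v om (p : nat -> nat) :
  0 < pk I -> (forall s, s < pk I -> p s <= pk I) -> low I v om p <= pk I *
    ones I.
Proof.
move=> k0 lep; rewrite /low /ones big_split_ord mulnDr; apply: leq_add.
  rewrite big_distrr; apply: leq_sum => j _ /=.
  by rewrite leq_mul2r; case: (_ && _); rewrite ?k0 orbT.
rewrite big_distrr; apply: leq_sum => s _ /=.
by rewrite leq_mul2r lep ?orbT.
Qed.

Lemma out_deg_le I v om : out_deg I v om <= pk I.
Proof.
rewrite -[leqRHS]muln1 -[X in X * 1]card_ord -sum_nat_const.
by apply: leq_sum => i _; case: (_ && _).
Qed.

Lemma vertex_sound I v c c' :
  0 < pk I -> ~~ covered I v -> c + pk I * ones I < big I ->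
  reach (ops_vertex I v) c c' ->
  exists om p, split_ok I v om p /\ c' = c + low I v om p.
Proof.
move=> k0 /negPf ncov ltc; rewrite /ops_vertex ncov.
case/reach_cat=> c1 /edges_sound[om E1] /reach_cat[c2 /conv_sound[p [lep E2]]].
case/reach1=> mv; rewrite inE => /eqP -> [t /= [ltt]].
rewrite !add0n => Et E'; subst t c'; exists om, p.
have ltl := low_le v om k0 lep.
have [E3 E4] : part_size I p = out_deg I v om /\ c2 = c + low I v om p.
  apply: (@divmod_uniq (big I)) => //; first by lia.
  rewrite [LHS]addnC E2 E1 /low; lia.
by [].
Qed.

Lemma vertex_complete I v c om p :
  ~~ covered I v -> split_ok I v om p -> c + low I v om p < big I ->
  reach (ops_vertex I v) c (c + low I v om p).
Proof.
move=> /negPf ncov [lep Es] lt; rewrite /ops_vertex ncov.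
apply/reach_cat; exists (c + (in_sum I v om + out_deg I v om * big I)).
  apply: edges_complete.
  apply: (@leq_trans (big I + out_deg I v om * big I)).
    by rewrite addnA ltn_add2r; move: lt; rewrite /low; lia.
  by rewrite -mulSn leq_mul2r ltnS out_deg_le orbT.
apply/reach_cat; exists (c + low I v om p).
  rewrite -Es /low !addnA; apply: conv_complete => //.
    by rewrite -addnA.
  by rewrite Es out_deg_le.
apply/reach1; exists (0, 0, big I); first by rewrite inE.
by exists (c + low I v om p).
Qed.

(* A star of size s goes to the cover vertex j < pk I, or, for j = pk I, to
   some vertex outside of the cover. *)
Definition star_wt (I : inst) (s j : nat) : nat :=
  if j < pk I then s * wt I j else wt I (pk I + s - 1).

Definition star_choice (I : inst) (s : nat) (b : nat -> nat) (a : nat) : Prop :=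
  \sum_(j < (pk I).+1) b j = a /\ (pk I < s -> b (pk I) = 0).

Definition star_sum (I : inst) (s : nat) (b : nat -> nat) : nat :=
  \sum_(j < (pk I).+1) b j * star_wt I s j.

Lemma gstep_star I s c c' :
  gstep (star_shifts I s) c c' ->
  exists j, [/\ j < (pk I).+1, pk I < s -> j != pk I & c' + star_wt I s j = c].
Proof.
move=> [mv]; rewrite mem_cat => /orP[/flatten_mapP[j]|].
  rewrite mem_iota inE add0n /= => ltj /eqP -> /shifts_subm E.
  exists j; rewrite /star_wt ltj; split=> //; first by rewrite ltnS ltnW.
  by rewrite (ltn_eqF ltj).
case: leqP => // les; rewrite inE => /eqP -> /shifts_subm E.
by exists (pk I); rewrite /star_wt ltnn leqnn; split.
Qed.

Lemma gstep_star_ex I s j c :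
  j < (pk I).+1 -> (pk I < s -> j != pk I) -> c + star_wt I s j < top I ->
  gstep (star_shifts I s) (c + star_wt I s j) c.
Proof.
rewrite ltnS leq_eqVlt /star_wt => /orP[/eqP -> |ltj _].
  rewrite ltnn eqxx => nlt lt; exists (subm I (wt I (pk I + s - 1))).
    rewrite mem_cat leqNgt; case: ltnP nlt => [_ /(_ isT) //|_ _].
    by rewrite inE eqxx orbT.
  exact: shifts_subm_ex.
rewrite ltj => lt; exists (subm I (s * wt I j)); last exact: shifts_subm_ex.
rewrite mem_cat; apply/orP; left; apply/flatten_mapP; exists j.
  by rewrite mem_iota.
by rewrite inE.
Qed.

Lemma sum_delta N (j : 'I_N) (F : nat -> nat) :
  \sum_(i < N) (i == j :> nat) * F i = F j.
Proof.
rewrite (bigD1 j) //= eqxx mul1n big1 ?addn0 // => i ne.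
by rewrite -val_eqE in ne; rewrite (negPf ne).
Qed.

Lemma sum_delta1 N (j : 'I_N) : \sum_(i < N) (i == j :> nat) = 1.
Proof.
by rewrite -[RHS](sum_delta j (fun=> 1)); apply: eq_bigr => i _; rewrite muln1.
Qed.

Lemma copies_sound I s N c c' :
  reach (cats N (fun=> [:: star_shifts I s])) c c' ->
  exists2 b, star_choice I s b N & c' + star_sum I s b = c.
Proof.
elim: N c' => [|N IH] c'.
  rewrite cats_nil /= => <-; exists (fun=> 0); first by split=> //;
    rewrite big1.
  by rewrite /star_sum big1 ?addn0.
rewrite catsS => /reach_cat[c1 /IH[b [Eb bk] <-] /reach1 /gstep_star].
move=> [j [ltj nj <-]]; exists (fun i => b i + (i == j)); first split.
- by rewrite big_split /= Eb (sum_delta1 (Ordinal ltj)) addn1.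
- by move=> lts; rewrite bk // eq_sym (negPf (nj lts)).
rewrite /star_sum; under eq_bigr do rewrite mulnDl.
rewrite big_split /= (sum_delta (Ordinal ltj) (star_wt I s)) /=.
by rewrite addnA addnAC.
Qed.

Lemma copies_complete I s N c b :
  star_choice I s b N -> c + star_sum I s b < top I ->
  reach (cats N (fun=> [:: star_shifts I s])) (c + star_sum I s b) c.
Proof.
elim: N c b => [|N IH] c b [Eb bk] lt.
  rewrite cats_nil /= /star_sum big1 ?addn0 // => j _.
  move/eqP: Eb; rewrite sum_nat_eq0 => /forallP /(_ j) /eqP -> //.
have [j bj] : exists j : 'I_(pk I).+1, 0 < b j.
  apply/existsP; rewrite -[[exists _, _]]negbK negb_exists.
  apply/negP => /forallP b0; move: Eb; rewrite big1 // => j _.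
  by have := b0 j; case: (b j).
pose b' i := b i - (i == j :> nat).
have bE i : b i = b' i + (i == j :> nat).
  by rewrite /b'; case: eqP => [->|_]; lia.
have sE : star_sum I s b = star_sum I s b' + star_wt I s j.
  rewrite /star_sum; under eq_bigr do rewrite bE mulnDl.
  by rewrite big_split /= (sum_delta j (star_wt I s)).
have Eb' : star_choice I s b' N.
  split; last by move=> /bk; rewrite /b' => ->.
  apply/eqP; rewrite -eqSS -Eb -addn1; apply/eqP.
  under [RHS]eq_bigr do rewrite bE.
  by rewrite big_split /= sum_delta1.
rewrite catsS; apply/reach_cat; exists (c + star_wt I s j).
  by rewrite sE [star_sum _ _ _ + _]addnC addnA in lt *; apply: IH.
apply/reach1; apply: gstep_star_ex => //.
  by move=> /bk bk0; apply: contraL bj => /eqP ->; rewrite bk0.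
by apply: leq_ltn_trans lt; rewrite leq_add2l sE leq_addl.
Qed.

Definition stars_sum (I : inst) (b : nat -> nat -> nat) : nat :=
  \sum_(i < pd I) star_sum I (ps I i) (b i).

Lemma stars_sound I c c' :
  reach (ops_stars I) c c' ->
  exists b, (forall i, i < pd I -> star_choice I (ps I i) (b i) (pa I i)) /\
    c' + stars_sum I b = c.
Proof.
move=> /(cats_sound_T (C := nat -> nat) (fun=> 0)
  (P := fun i b => star_choice I (ps I i) b (pa I i))
  (w := fun _ _ => 0) (o := fun i b => star_sum I (ps I i) b)) [|b [Pb E]].
  move=> i {}c {}c1 lti /copies_sound[b Pb <-].
  by exists b; split=> //; rewrite addn0.
exists b; split=> //; rewrite /stars_sum.
by move: E; rewrite [X in _ = _ + X]big1 ?addn0.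
Qed.

Lemma stars_complete I b c :
  (forall i, i < pd I -> star_choice I (ps I i) (b i) (pa I i)) ->
  c + stars_sum I b < top I ->
  reach (ops_stars I) (c + stars_sum I b) c.
Proof.
move=> Pb; rewrite /ops_stars /stars_sum.
elim: (pd I) Pb c => [|d IH] Pb c; first by rewrite big_ord0 addn0.
rewrite big_ord_recr /= => lt; rewrite catsS; apply/reach_cat.
exists (c + star_sum I (ps I d) (b d)); last first.
  by apply: copies_complete; [apply: Pb | apply: leq_ltn_trans lt; lia].
rewrite [_ + star_sum _ _ _]addnC addnA in lt *; apply: IH => //.
by move=> i lti; apply: Pb; apply: ltnW.
Qed.

Definition centre (e : nat -> nat -> bool) (l i j : nat) : bool :=
  if e i j then i == l else j == l.

Definition in_deg (I : inst) (e om : nat -> nat -> bool) (l : nat) : nat :=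
  \sum_(i < pk I) \sum_(j < i) padj I (px I i) (px I j) *
    centre e l i j +
  \sum_(v < pn I) (~~ covered I v && (padj I v (px I l) && om v l)).

Definition used (I : inst) (p : nat -> nat -> nat) (s : nat) : nat :=
  \sum_(v < pn I) ~~ covered I v * p v s.

Definition spent (I : inst) (b : nat -> nat -> nat) (l : nat) : nat :=
  \sum_(i < pd I) b i l * ps I i.

Definition released (I : inst) (b : nat -> nat -> nat) (s : nat) : nat :=
  \sum_(i < pd I) (ps I i == s.+1) * b i (pk I).

Definition feasible (I : inst) : Prop :=
  exists (e om : nat -> nat -> bool) (p b : nat -> nat -> nat),
    [/\ forall v, v < pn I -> ~~ covered I v -> split_ok I v (om v) (p v),
        forall i, i < pd I -> star_choice I (ps I i) (b i) (pa I i),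
        forall l, l < pk I -> in_deg I e om l = spent I b l
      & forall s, s < pk I -> used I p s = released I b s].

Definition glue (k : nat) (f g : nat -> nat) (l : nat) : nat :=
  if l < k then f l else g (l - k).

Lemma glue_sum I (f g : nat -> nat) :
  \sum_(l < pk I) f l * wt I l + \sum_(s < pk I) g s * wt I (pk I + s) =
  \sum_(l < pk I + pk I) glue (pk I) f g l * base I ^ l.
Proof.
rewrite big_split_ord /glue; congr (_ + _); apply: eq_bigr => l _ /=.
  by rewrite ltn_ord.
by rewrite ltnNge leq_addr /= addKn.
Qed.

Lemma glue_lt k (f g : nat -> nat) B :
  (forall l, l < k -> f l < B) -> (forall l, l < k -> g l < B) ->
  forall l, l < k + k -> glue k f g l < B.
Proof.
move=> ltf ltg l ltl; rewrite /glue; case: (ltnP l k) => [/ltf //|le].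
by apply: ltg; lia.
Qed.

Lemma pair_digits_inj I (F F' G G' : nat -> nat) :
  (forall l, l < pk I -> F l < base I) -> (forall l, l < pk I -> G l < base I)
    ->
  (forall l, l < pk I -> F' l < base I) -> (forall l, l < pk I -> G' l < base
    I) ->
  \sum_(l < pk I) F l * wt I l + \sum_(s < pk I) G s * wt I (pk I + s) =
  \sum_(l < pk I) F' l * wt I l + \sum_(s < pk I) G' s * wt I (pk I + s) ->
  (forall l, l < pk I -> F l = F' l) /\ (forall s, s < pk I -> G s = G' s).
Proof.
move=> ltF ltG ltF' ltG'; rewrite !glue_sum.
move=> /(digits_inj (glue_lt ltF ltG) (glue_lt ltF' ltG')) inj.
split=> l ltl; first by have := inj l; rewrite /glue ltl; apply; lia.
have := inj (pk I + l); rewrite /glue [_ < pk I]ltnNge leq_addr /= addKn;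
  apply; lia.
Qed.

Lemma ones_lt I M : M < base I -> M * ones I < big I.
Proof.
move=> lt; rewrite /ones big_distrr /=.
by apply: (digits_lt (u := fun=> M)).
Qed.

Lemma cover_sum_le I e : cover_sum I e <= pk I * pk I * ones I.
Proof.
have wle l : l < pk I -> wt I l <= ones I.
  move=> ltl; have lt : l < pk I + pk I by lia.
  by rewrite /ones (bigD1 (Ordinal lt)) //= leq_addr.
have C N M (F : nat -> nat) : (forall i, i < N -> F i <= M) ->
    \sum_(i < N) F i <= N * M.
  move=> le; rewrite -[N in N * _]card_ord -sum_nat_const.
  by apply: leq_sum => i _; apply: le.
rewrite -mulnA.
apply: (C _ _ (fun i => \sum_(j < i) padj I (px I i) (px I j) *
  (if e i j then wt I i else wt I j))) => i lti.
apply: (@leq_trans (i * ones I)); last by rewrite leq_mul2r ltnW ?orbT.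
apply: (C _ _ (fun j => padj I (px I i) (px I j) *
  (if e i j then wt I i else wt I j))) => j ltj.
have ltjk := ltn_trans ltj lti.
by case: (padj _ _ _) (e i j) => -[] //; rewrite mul1n wle.
Qed.

Definition vertices_sum (I : inst) (om : nat -> nat -> bool)
    (p : nat -> nat -> nat) : nat :=
  \sum_(v < pn I) ~~ covered I v * low I v (om v) (p v).

Lemma vertices_sound I c c' :
  0 < pk I <= pn I -> c <= pk I * pk I * ones I ->
  reach (cats (pn I) (ops_vertex I)) c c' ->
  exists om p,
    (forall v, v < pn I -> ~~ covered I v -> split_ok I v (om v) (p v)) /\
    c' = c + vertices_sum I om p.
Proof.
move=> /andP[k0 lekn] lec.
move=> /(cats_sound (C := (nat -> bool) * (nat -> nat)) (xpredT, fun=> 0)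
  (P := fun v x => ~~ covered I v -> split_ok I v x.1 x.2)
  (w := fun v x => ~~ covered I v * low I v x.1 x.2) (o := fun _ _ => 0)
  (J := fun v c => c <= (pk I * pk I + v * pk I) * ones I)).
case.
- move=> v {lec}c {}c' ltv lec r.
  case cov: (covered I v).
    move: r; rewrite /ops_vertex cov /= => <-; split.
      by apply: leq_trans lec _; rewrite leq_mul2r mulSn; apply/orP; right; lia.
    by exists (xpredT, fun=> 0).
  have [||om [p [so ->]]] := vertex_sound k0 _ _ r; first by rewrite cov.
    apply: (@leq_ltn_trans ((pk I * pk I + v.+1 * pk I) * ones I)).
      rewrite mulSn [pk I + _]addnC addnA mulnDl.
      by rewrite leq_add2r.
    by apply: ones_lt; rewrite /base; nia.
  split; last by exists (om, p); rewrite mul1n addn0.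
  rewrite mulSn [pk I + _]addnC addnA mulnDl leq_add //.
  by case: so => so _; apply: low_le.
- by rewrite mul0n addn0.
move=> _ [ch [so E]]; exists (fun v => (ch v).1), (fun v => (ch v).2).
by split=> //; move: E; rewrite big1 ?addn0.
Qed.

Lemma vertices_complete I om p c :
  (forall v, v < pn I -> ~~ covered I v -> split_ok I v (om v) (p v)) ->
  c + vertices_sum I om p < big I ->
  reach (cats (pn I) (ops_vertex I)) c (c + vertices_sum I om p).
Proof.
move=> so lt; apply: (cats_add_path
  (w := fun v => ~~ covered I v * low I v (om v) (p v)) lt).
move=> v {lt}c ltv; case cov: (covered I v).
  by rewrite mul0n addn0 /ops_vertex cov.
by rewrite mul1n => lt; apply: vertex_complete; rewrite ?cov //; apply: so;
  rewrite ?cov.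
Qed.

Lemma graph_code I e om p :
  cover_sum I e + vertices_sum I om p =
  \sum_(l < pk I) in_deg I e om l * wt I l +
  \sum_(s < pk I) used I p s * wt I (pk I + s).
Proof.
rewrite /in_deg; under [in RHS]eq_bigr do rewrite mulnDl.
rewrite big_split /= -addnA; congr (_ + _).
  under [in RHS]eq_bigr => l _.
    rewrite big_distrl /=.
    under eq_bigr do rewrite big_distrl /=.
    over.
  rewrite exchange_big /=; apply: eq_bigr => i _.
  rewrite exchange_big /=; apply: eq_bigr => j _.
  under eq_bigr do rewrite -mulnA.
  rewrite -big_distrr /=; congr (_ * _).
  have ltj := ltn_trans (ltn_ord j) (ltn_ord i).
  rewrite /centre; case: (e i j).
    by rewrite -(sum_delta i (wt I)); apply: eq_bigr => l _; rewrite eq_sym.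
  by rewrite -(sum_delta (Ordinal ltj) (wt I)); apply: eq_bigr => l _;
    rewrite eq_sym.
rewrite /vertices_sum /low; under [LHS]eq_bigr do rewrite mulnDr.
rewrite big_split /=; congr (_ + _).
  under [in RHS]eq_bigr do rewrite big_distrl /=.
  rewrite exchange_big /=; apply: eq_bigr => v _.
  by rewrite /in_sum big_distrr /=; apply: eq_bigr => l _;
    case: (covered I v); rewrite ?mul1n.
under [in RHS]eq_bigr do rewrite big_distrl /=.
rewrite exchange_big /=; apply: eq_bigr => v _.
by rewrite /part_sum big_distrr /=; apply: eq_bigr => s _; rewrite mulnA.
Qed.

Lemma stars_code I b :
  (forall i, i < pd I -> 0 < ps I i) ->
  (forall i, i < pd I -> star_choice I (ps I i) (b i) (pa I i)) ->
  stars_sum I b = \sum_(l < pk I) spent I b l * wt I l +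
                  \sum_(s < pk I) released I b s * wt I (pk I + s).
Proof.
move=> s0 Pb; rewrite /stars_sum /star_sum.
under eq_bigr do rewrite big_ord_recr /=.
rewrite big_split /=; congr (_ + _).
  under [in RHS]eq_bigr do rewrite big_distrl /=.
  rewrite exchange_big /=; apply: eq_bigr => l _; apply: eq_bigr => i _.
  by rewrite /star_wt ltn_ord mulnA.
under [in RHS]eq_bigr do rewrite big_distrl /=.
rewrite exchange_big /=; apply: eq_bigr => i _.
have [_ bk] := Pb i (ltn_ord i); have si := s0 i (ltn_ord i).
case: (leqP (ps I i) (pk I)) => [les|/bk ->]; last first.
  by rewrite mul0n big1 // => s _; rewrite muln0.
have lts : (ps I i).-1 < pk I by lia.
rewrite /star_wt ltnn -addnBA // subn1.
rewrite -(sum_delta (Ordinal lts) (fun s => b i (pk I) * wt I (pk I + s))).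
by apply: eq_bigr => s _ /=; rewrite -mulnA -[ps I i in RHS]prednK // eqSS
  eq_sym.
Qed.

Lemma reach_feasible I :
  0 < pk I <= pn I -> (forall i, i < pd I -> 0 < ps I i) ->
  \sum_(i < pd I) pa I i * ps I i <= pn I * pn I ->
  reach (ops I) 0 0 <-> feasible I.
Proof.
move=> kn s0 le_total; have /andP[k0 lekn] := kn.
have C N M (F : nat -> nat) : (forall i, i < N -> F i <= M) ->
    \sum_(i < N) F i <= N * M.
  move=> le; rewrite -[N in N * _]card_ord -sum_nat_const.
  by apply: leq_sum => i _; apply: le.
have in_le e om l : in_deg I e om l < base I.
  rewrite /base ltnS mulnDr /in_deg leq_add //.
    apply: (@leq_trans (pk I * pk I)); last exact: leq_mul.
    apply: (C _ _ (fun i => \sum_(j < i) padj I (px I i) (px I j) *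
       centre e l i j)) => i lti.
    apply: (@leq_trans (i * 1)); last by lia.
    apply: (C _ _ (fun j => padj I (px I i) (px I j) *
       centre e l i j)) => j _.
    by case: (padj _ _ _); rewrite ?mul1n ?leq_b1.
  apply: (C _ _ (fun v => nat_of_bool
    (~~ covered I v && (padj I v (px I l) && om v l)))) => v ltv.
  by apply: leq_trans (leq_b1 _) _; lia.
have used_le p s : (forall v, v < pn I -> ~~ covered I v -> p v s <= pk I) ->
    used I p s < base I.
  move=> lep; rewrite ltnS; apply: (@leq_trans (pn I * pn I)); last by lia.
  apply: (C _ _ (fun v => ~~ covered I v * p v s)) => v ltv.
  case cov: (covered I v) => //=; rewrite mul1n.
  by apply: leq_trans lekn; apply: lep; rewrite ?cov.
have b_le b i l : (forall i, i < pd I -> star_choice I (ps I i) (b i) (pa I i))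
  ->
    i < pd I -> l < (pk I).+1 -> b i l <= pa I i.
  move=> Pb lti ltl; have [<- _] := Pb i lti.
  by rewrite (bigD1 (Ordinal ltl)) //= leq_addr.
have spent_le b l : (forall i, i < pd I -> star_choice I (ps I i) (b i) (pa I
  i)) ->
    l < pk I -> spent I b l < base I.
  move=> Pb ltl; rewrite ltnS; apply: (@leq_trans (pn I * pn I)); last by lia.
  apply: leq_trans le_total; apply: leq_sum => i _.
  by rewrite leq_mul2r (b_le b) ?orbT // ltnW.
have rel_le b s : (forall i, i < pd I -> star_choice I (ps I i) (b i) (pa I i))
  ->
    released I b s < base I.
  move=> Pb; rewrite ltnS; apply: (@leq_trans (pn I * pn I)); last by lia.
  apply: leq_trans le_total; apply: leq_sum => i _.
  case: eqP => // _; rewrite mul1n (leq_trans (b_le b i _ Pb _ _)) //.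
  by rewrite leq_pmulr // s0.
split.
  case/reach_cat=> c1 /cover_sound[e E1] /reach_cat[c2 r2 r3].
  rewrite add0n in E1; subst c1.
  have [om [p [so E2]]] := vertices_sound kn (cover_sum_le I e) r2.
  have [b [Pb E3]] := stars_sound r3.
  have [|||||D1 D2] := @pair_digits_inj I (in_deg I e om) (spent I b)
      (used I p) (released I b).
  - by move=> l ltl; apply: in_le.
  - by move=> s lts; apply: used_le => v ltv /(so v ltv)[lep _]; apply: lep.
  - by move=> l ltl; apply: spent_le.
  - by move=> s lts; apply: rel_le.
  - by rewrite -graph_code -stars_code // -E2 -E3.
  by exists e, om, p, b.
case=> e [om [p [b [so Pb D1 D2]]]].
have E : cover_sum I e + vertices_sum I om p = stars_sum I b.
  rewrite graph_code stars_code //; congr (_ + _); apply: eq_bigr => l _.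
    by rewrite D1.
  by rewrite D2.
have lt : cover_sum I e + vertices_sum I om p < big I.
  rewrite graph_code glue_sum; apply: digits_lt; apply: glue_lt => l ltl //.
  by apply: used_le => v ltv /(so v ltv)[lep _]; apply: lep.
have ltt := leq_trans lt (big_le_top I).
apply/reach_cat; exists (cover_sum I e).
  by have := @cover_complete I 0 e; rewrite add0n; apply; lia.
apply/reach_cat; exists (stars_sum I b).
  by rewrite -E; apply: vertices_complete.
have := stars_complete (c := 0) Pb; rewrite add0n; apply.
by rewrite -E.
Qed.

(** * Orientations *)

(* o v u means that v is the centre of the star containing the edge uv, and
   b i v is the number of stars of the i-th size with centre v. *)
Definition centred (I : sd_instance) (o : rel 'I_(sd_n I))
    (b : 'I_(sd_d I) -> 'I_(sd_n I) -> nat) : Prop :=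
  [/\ forall u v, sd_graph I u v -> o u v = ~~ o v u,
      forall i, \sum_v b i v = tnth (sd_a I) i
    & forall v, \sum_i b i v * tnth (sd_s I) i =
                \sum_u (sd_graph I v u && o v u)].

Arguments centred I o b : clear implicits.

Definition inst_of (I : sd_instance) (X : seq 'I_(sd_n I)) : inst :=
  Inst (sd_n I) (sd_d I)
    (fun u v => nth 0 (adj_matrix (sd_graph I)) (u * sd_n I + v) != 0)
    (nth 0 (sd_s I)) (nth 0 (sd_a I)) (size X) (nth 0 (map val X)).

Lemma nth_flatten_const (T : Type) (x0 : T) n (ss : seq (seq T)) r c :
  all (fun s => size s == n) ss -> r < size ss -> c < n ->
  nth x0 (flatten ss) (r * n + c) = nth x0 (nth [::] ss r) c.
Proof.
move=> + + ltc; elim: ss r => [//|s ss IH] [|r] /= /andP[/eqP Es all_n] ltr.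
  by rewrite nth_cat Es ltc.
by rewrite nth_cat Es mulSn -addnA ltnNge leq_addr /= addKn IH.
Qed.

Lemma nth_adj_matrix n (G : sgraph 'I_n) (u v : 'I_n) :
  nth 0 (adj_matrix G) (u * n + v) = G u v.
Proof.
rewrite /adj_matrix nth_flatten_const //.
- by rewrite (nth_map u) ?size_enum_ord // (nth_map u) ?size_enum_ord //
  !nth_ord_enum.
- by apply/allP => s /mapP[w _ ->]; rewrite size_map size_enum_ord.
- by rewrite size_map size_enum_ord.
Qed.

Lemma pair_sum k (g : nat -> nat -> bool) e l :
  l < k -> (forall i j, i < k -> j < k -> g i j = g j i) ->
  (forall i, i < k -> g i i = false) ->
  \sum_(i < k) \sum_(j < i) g i j * centre e l i j =
  \sum_(j < k) (g l j && (if j < l then e l j else ~~ e j l)).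
Proof.
move=> ltl gC gI.
have E i : i < k -> \sum_(j < i) g i j * centre e l i j =
    \sum_(j < k) ((i == l) * ((j < i) && (g i j && e i j)) +
                  (j == l :> nat) * ((j < i) && (g i j && ~~ e i j))).
  move=> lti; rewrite (big_ord_widen k (fun j => g i j * centre e l i j) (ltnW
    lti)).
  rewrite big_mkcond /=; apply: eq_bigr => j _.
  rewrite /centre; case: (j < i); case: (g i j); case: (e i j);
    rewrite ?muln0 ?muln1 ?addn0 ?mul1n ?mul0n ?add0n //.
rewrite (eq_bigr (fun i : 'I_k =>
    (i == l :> nat) * (\sum_(j < k) ((j < i) && (g i j && e i j))) +
    \sum_(j < k) (j == l :> nat) * ((j < i) && (g i j && ~~ e i j))));
      last first.
  by move=> i _; rewrite E // big_split /= -big_distrr.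
rewrite big_split /= [X in _ + X]exchange_big /=.
rewrite (sum_delta (Ordinal ltl)
  (fun i => \sum_(j < k) ((j < i) && (g i j && e i j)))) /=.
under [X in _ + X]eq_bigr do rewrite -big_distrr /=.
rewrite (sum_delta (Ordinal ltl)
  (fun j => \sum_(i < k) ((j < i) && (g i j && ~~ e i j)))) /=.
rewrite -big_split /=; apply: eq_bigr => j _; rewrite [g j l]gC //.
by case: (ltngtP j l) => [||->]; rewrite ?gI // ?addn0 ?add0n ?andbF.
Qed.

Lemma covered_inst_of I (X : seq 'I_(sd_n I)) v :
  covered (inst_of X) (val v) = (v \in X).
Proof.
rewrite /covered /= -(mem_map val_inj) -[size X](size_map val).
by rewrite -/(mkseq _ _) mkseq_nth.
Qed.

Lemma padj_inst_of I (X : seq 'I_(sd_n I)) u v :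
  padj (inst_of X) (val u) (val v) = sd_graph I u v.
Proof. by rewrite /= nth_adj_matrix; case: (sd_graph I u v). Qed.

Lemma px_inst_of I (X : seq 'I_(sd_n I)) x0 j :
  j < size X -> px (inst_of X) j = val (nth x0 X j).
Proof. by move=> lt; rewrite /= (nth_map x0). Qed.

Lemma sum_cover (T : finType) (X : seq T) x0 (F : T -> nat) :
  uniq X -> \sum_(v in X) F v = \sum_(j < size X) F (nth x0 X j).
Proof.
by move=> uX; rewrite -big_uniq //= (big_nth x0) big_mkord.
Qed.

Lemma sum_split (T : finType) (X : seq T) x0 (F : T -> nat) :
  uniq X -> \sum_v F v =
    \sum_(j < size X) F (nth x0 X j) + \sum_v (v \notin X) * F v.
Proof.
move=> uX; rewrite (bigID (mem X)) /= (sum_cover x0) //; congr (_ + _).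
rewrite big_mkcond; apply: eq_bigr => v _ /=.
by case: (v \in X); rewrite ?mul1n.
Qed.

Lemma vertex_coverP (T : finType) (G : sgraph T) (X : seq T) :
  vertex_cover G [set x in X] ->
  forall u v, G u v -> u \notin X -> v \in X.
Proof.
move=> /forallP H u v Guv /negPf nu; have /forallP/(_ v) := H u.
by rewrite Guv !inE nu.
Qed.

Lemma centred_feasible I (X : seq 'I_(sd_n I)) o b :
  uniq X -> vertex_cover (sd_graph I) [set x in X] -> 0 < size X ->
  centred I o b -> feasible (inst_of X).
Proof.
move=> uX cov k0 [oC ba bs]; set J := inst_of X; set k := size X.
pose x0 : 'I_(sd_n I) := tnth (in_tuple X) (Ordinal k0).
pose x := nth x0 X.
pose b1 i := if insub i is Some i' then b i' else fun=> 0.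
have b1E (i : 'I_(sd_d I)) : b1 i = b i by rewrite /b1 valK.
pose lift v := insubd x0 v.
have liftE (v : 'I_(sd_n I)) : lift v = v by apply: valKd.
pose G := sd_graph I; pose s := tnth (sd_s I).
have psE (i : 'I_(sd_d I)) : ps J i = s i by rewrite /s (tnth_nth 0).
have paE (i : 'I_(sd_d I)) : pa J i = tnth (sd_a I) i by rewrite (tnth_nth 0).
have covP := vertex_coverP cov.
have out_degE (v : 'I_(sd_n I)) : v \notin X ->
    out_deg J v (fun j => o (x j) v) = \sum_i b i v * s i.
  move=> nv; rewrite bs (sum_split x0 _ uX) [X in _ + X]big1 ?addn0.
    apply: eq_bigr => j _; rewrite (px_inst_of x0) // padj_inst_of -/(x j) -/G.
    by case Gvx: (G v (x j)) => //=; rewrite (oC v (x j)).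
  move=> u _; case Guv: (sd_graph I v u); last by rewrite muln0.
  by rewrite (covP _ _ Guv nv).
have b_small (v : 'I_(sd_n I)) i : v \notin X -> b i v != 0 -> s i <= k.
  move=> nv b0; apply: leq_trans (out_deg_le J v (fun j => o (x j) v)).
  by rewrite out_degE // (bigD1 i) //= (leq_trans _ (leq_addr _ _)) //
    leq_pmull // lt0n.
exists (fun i j => o (x i) (x j)), (fun v j => o (x j) (lift v)),
  (fun v s' => \sum_i (s i == s'.+1) * b i (lift v)),
  (fun i j => if j < k then b1 i (x j) else \sum_v (v \notin X) * b1 i v).
have size_part (v : 'I_(sd_n I)) : v \notin X ->
    part_size J (fun s' => \sum_i (s i == s'.+1) * b i v) =
    out_deg J v (fun j => o (x j) v).
  move=> nv; rewrite out_degE // /part_size.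
  under [LHS]eq_bigr do rewrite big_distrr /=.
  rewrite exchange_big /=; apply: eq_bigr => i _.
  have [->|b0] := eqVneq (b i v) 0.
    by rewrite mul0n big1 // => s' _; rewrite !muln0.
  have si0 : 0 < s i by apply: sd_s_pos.
  have lts : (s i).-1 < k by rewrite prednK // (b_small v).
  rewrite -[s i in RHS]prednK // mulnC.
  rewrite -(sum_delta (Ordinal lts) (fun s' => s'.+1 * b i v)).
  apply: eq_bigr => s' _ /=.
  by rewrite mulnCA -[s i in LHS]prednK // eqSS eq_sym.
split.
- move=> v ltv; rewrite -[v]/(val (Ordinal ltv)) covered_inst_of => nv.
  rewrite liftE; split; last exact: size_part.
  move=> s' lts; apply: leq_trans (out_deg_le J (Ordinal ltv) (fun j => o (x j)
    (Ordinal ltv))).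
  rewrite -size_part // /part_size (bigD1 (Ordinal lts)) //=.
  by rewrite (leq_trans _ (leq_addr _ _)) // leq_pmull.
- move=> i lti; rewrite -[i]/(val (Ordinal lti)) psE paE; split.
    rewrite big_ord_recr /= ltnn -ba (sum_split x0 _ uX); congr (_ + _).
      by apply: eq_bigr => j _; rewrite ltn_ord (b1E (Ordinal lti)).
    by apply: eq_bigr => v _; rewrite (b1E (Ordinal lti)).
  rewrite ltnn => ltk; rewrite big1 // => v _; rewrite (b1E (Ordinal lti)).
  have [//|nv] := boolP (v \in X); apply/eqP; rewrite mul1n -leqn0 leqNgt.
  by apply: contraTN ltk => b0; rewrite -leqNgt (b_small v) // -lt0n.
- move=> l ltl; rewrite /in_deg.
  rewrite (@pair_sum k (fun i j => padj J (px J i) (px J j))) //; first last.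
  + by move=> i lti; rewrite !(px_inst_of x0) // padj_inst_of adj_irr.
  + by move=> i j lti ltj; rewrite !(px_inst_of x0) // !padj_inst_of adj_sym.
  have -> : spent J (fun i j => if j < k then b1 i (x j)
        else \sum_v (v \notin X) * b1 i v) l = \sum_i b i (x l) * s i.
    by apply: eq_bigr => i _; rewrite ltl b1E psE.
  rewrite bs [RHS](sum_split x0 _ uX); congr (_ + _).
    apply: eq_bigr => j _; rewrite !(px_inst_of x0) // padj_inst_of -/(x _)
      -/(x _).
    case Glj: (sd_graph I (x l) (x j)) => //=.
    by case: (j < l) => //; rewrite (oC _ _ Glj).
  apply: eq_bigr => v _; rewrite covered_inst_of liftE (px_inst_of x0) //.
  rewrite padj_inst_of -/(x _) adj_sym.
  by case: (v \in X); rewrite ?mul1n.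
- move=> s' lts; rewrite /used /released /= ltnn.
  under eq_bigr do rewrite covered_inst_of liftE big_distrr /=.
  rewrite exchange_big /=; apply: eq_bigr => i _.
  rewrite -[nth 0 _ _]/(ps J i) psE b1E big_distrr /=.
  by apply: eq_bigr => v _; rewrite mulnCA.
Qed.

Lemma feasible_centred I (X : seq 'I_(sd_n I)) :
  uniq X -> vertex_cover (sd_graph I) [set x in X] -> 0 < size X ->
  feasible (inst_of X) -> exists o b, centred I o b.
Proof.
move=> uX cov k0; set J := inst_of X; set k := size X.
move=> [e [om [p [b [so sc D1 D2]]]]].
pose x0 : 'I_(sd_n I) := tnth (in_tuple X) (Ordinal k0).
pose x := nth x0 X.
pose s := tnth (sd_s I).
have psE (i : 'I_(sd_d I)) : ps J i = s i by rewrite /s (tnth_nth 0).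
have paE (i : 'I_(sd_d I)) : pa J i = tnth (sd_a I) i by rewrite (tnth_nth 0).
have s0 i : 0 < s i by apply: sd_s_pos.
have s_inj : injective s by apply/tuple_uniqP; apply: sd_s_uniq.
have covP := vertex_coverP cov.
have xP j : j < k -> x j \in X by apply: mem_nth.
have idx j : j < k -> index (x j) X = j by move=> ltj; apply: index_uniq.
pose o (u v : 'I_(sd_n I)) :=
  if u \in X then
    if v \in X then
      if index v X < index u X then e (index u X) (index v X)
      else ~~ e (index v X) (index u X)
    else om v (index u X)
  else ~~ om u (index v X).
pose b' (i : 'I_(sd_d I)) (v : 'I_(sd_n I)) :=
  if v \in X then b i (index v X) else (s i <= k) * p v (s i).-1.
exists o, b'; split.
- move=> u v Guv; rewrite /o.
  have [uin|nu] := boolP (u \in X); have [vin|nv] := boolP (v \in X).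
  + case: ltngtP => [||E]; rewrite ?negbK //.
    have Euv : u = v by rewrite -(nth_index x0 uin) -(nth_index x0 vin) E.
    by rewrite Euv adj_irr in Guv.
  + by rewrite negbK.
  + by [].
  + by rewrite (covP _ _ Guv nu) in nv.
- move=> i; have [ba bk] := sc i (ltn_ord i).
  rewrite -paE -ba big_ord_recr /= (sum_split x0 _ uX) /b'; congr (_ + _).
    by apply: eq_bigr => j _; rewrite xP // idx.
  have [les|lts] := leqP (s i) k; last first.
    rewrite bk ?psE // big1 // => v _.
    by case: (v \in X) => //=; rewrite leqNgt lts !muln0.
  have lts : (s i).-1 < k by rewrite prednK.
  have := D2 _ lts; rewrite /used /released => E.
  transitivity (\sum_(v < sd_n I) ~~ covered J v * p v (s i).-1).
    apply: eq_bigr => v _; rewrite covered_inst_of.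
    by case: (v \in X); rewrite ?mul1n // les.
  rewrite [LHS]E (bigD1 i) //= -[nth 0 _ _]/(ps J i) psE prednK // eqxx mul1n.
  rewrite big1 ?addn0 // => i' ne.
  rewrite -[nth 0 _ _]/(ps J i') psE; case: eqP => [/s_inj E'|] //.
  by rewrite E' eqxx in ne.
- move=> v; have [vin|nv] := boolP (v \in X).
    have ltl : index v X < k by rewrite index_mem.
    have xl : x (index v X) = v by apply: nth_index.
    set l := index v X in ltl xl *.
    have -> : \sum_i b' i v * s i = spent J b l.
      by apply: eq_bigr => i _; rewrite /b' vin psE.
    rewrite -D1 // /in_deg.
    rewrite (@pair_sum k (fun i j => padj J (px J i) (px J j))) //; first last.
    + by move=> i lti; rewrite !(px_inst_of x0) // padj_inst_of adj_irr.
    + by move=> i j lti ltj; rewrite !(px_inst_of x0) // !padj_inst_of adj_sym.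
    rewrite [RHS](sum_split x0 _ uX); congr (_ + _).
      apply: eq_bigr => j _; rewrite !(px_inst_of x0) // padj_inst_of.
      by rewrite -/(x l) -/(x j) xl /o vin xP // idx.
    apply: eq_bigr => u _; rewrite covered_inst_of (px_inst_of x0) //.
    rewrite padj_inst_of -/(x _) xl adj_sym /o vin.
    by case: (u \in X); rewrite ?mul1n.
  have [lep size_p] := so v (ltn_ord v) (etrans (congr1 negb (covered_inst_of X
    v)) nv).
  have -> : \sum_u (sd_graph I v u && o v u) = out_deg J v (om v).
    rewrite (sum_split x0 _ uX) [X in _ + X]big1 ?addn0.
      apply: eq_bigr => j _; rewrite (px_inst_of x0) // padj_inst_of.
      by rewrite -/(x j) /o (negPf nv) idx.
    move=> u _; case Guv: (sd_graph I v u); last by rewrite muln0.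
    by rewrite (covP _ _ Guv nv).
  rewrite -size_p /part_size.
  transitivity (\sum_(s' < k) \sum_i (s i == s'.+1) * (s'.+1 * p v s')).
    rewrite exchange_big /=; apply: eq_bigr => i _; rewrite /b' (negPf nv).
    have [les|lts] := leqP (s i) k; last first.
      rewrite !mul0n big1 // => s' _.
      by case: eqP => // E; move: lts; rewrite E ltnNge ltn_ord.
    have lts : (s i).-1 < k by rewrite prednK.
    rewrite mul1n -[X in _ * X](prednK (s0 i)) mulnC.
    rewrite -(sum_delta (Ordinal lts) (fun s' => s'.+1 * p v s')).
    by apply: eq_bigr => s' _ /=; rewrite -[s i in RHS]prednK // eqSS eq_sym.
  apply: eq_bigr => s' _; rewrite -big_distrl /=.
  have [p0|p0] := posnP (p v s'); first by rewrite p0 !muln0.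
  have [i0 Ei] : exists i0, s i0 == s'.+1.
    apply/existsP; rewrite -[[exists _, _]]negbK negb_exists.
    apply/negP => /forallP ne.
    have := D2 _ (ltn_ord s'); rewrite /released big1 => [|i _]; last first.
      by rewrite psE (negPf (ne i)).
    move/eqP; rewrite sum_nat_eq0 => /forallP/(_ v).
    by rewrite implyTb covered_inst_of nv mul1n -leqn0 leqNgt p0.
  rewrite (bigD1 i0) //= Ei big1 ?mul1n // => i ne.
  by case: eqP => // E; move: ne; rewrite (s_inj i i0) ?eqxx // E (eqP Ei).
Qed.

(** * Star decompositions *)

Lemma edgesP (T : finType) (G : sgraph T) (e : {set T}) :
  reflect (exists u v, G u v /\ e = [set u; v]) (e \in edges G).
Proof.
apply: (iffP imsetP) => [[[u v] /=]|[u [v [Guv ->]]]].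
  by rewrite inE /= => Guv ->; exists u, v.
by exists (u, v); rewrite ?inE.
Qed.

Lemma edge_neq (T : finType) (G : sgraph T) u v :
  [set u; v] \in edges G -> u != v.
Proof.
move=> /edgesP[x [y [Gxy E]]]; apply/eqP => uv; subst v.
have xu : x = u by apply/set1P; rewrite -(setUid [set u]) E set21.
have yu : y = u by apply/set1P; rewrite -(setUid [set u]) E set22.
by rewrite xu yu adj_irr in Gxy.
Qed.

Lemma set2_inj (T : finType) (v u w : T) :
  u != v -> w != v -> [set v; u] = [set v; w] -> u = w.
Proof.
move=> uv wv E; have : u \in [set v; w] by rewrite -E set22.
by rewrite !inE (negPf uv) => /eqP.
Qed.

Lemma star_copyP (T : finType) (G : sgraph T) l (F : {set {set T}}) :
  edge_set_of_copy (star l) G F <->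
  exists v, [/\ F \subset edges G, forall e, e \in F -> v \in e & #|F| = l].
Proof.
split.
  case/existsP=> W /andP[/andP[FG /forallP FW]] /existsP[f /and3P[/injectiveP
    fI /eqP fW H]].
  have {}H x y : star l x y = ([set f x; f y] \in F).
    by move/forallP/(_ x)/forallP/(_ y)/eqP: H.
  have EF : F = [set [set f None; f (Some i)] | i : 'I_l].
    apply/setP=> e; apply/idP/imsetP => [eF|[i _ ->]]; last by rewrite -H.
    have /edgesP[u [w [Guw Ee]]] := subsetP FG e eF.
    have eW : e \subset W by have := FW e; rewrite eF.
    have uW : u \in f @: [set: _] by rewrite fW (subsetP eW) // Ee set21.
    have wW : w \in f @: [set: _] by rewrite fW (subsetP eW) // Ee set22.
    have [x _ Eu] := imsetP uW; have [y _ Ew] := imsetP wW.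
    have := H x y; rewrite -Eu -Ew -Ee eF Ee Eu Ew /=.
    case: x y {Eu Ew} => [i|] [j|] //= _; [exists i|exists j] => //.
    by rewrite setUC.
  exists (f None); split=> //.
    by move=> e; rewrite EF => /imsetP[i _ ->]; rewrite set21.
  rewrite EF card_imset ?card_ord // => i j.
  move/set2_inj => E; suff [] : Some i = Some j by [].
  by apply/fI/E; apply/eqP => /fI.
move=> [v [FG vF cF]].
pose L := [set u | [set v; u] \in F].
have vL : v \notin L.
  by rewrite inE; apply/negP => /(subsetP FG)/edge_neq; rewrite eqxx.
have Lv u : u \in L -> u != v by apply: contraTneq => ->.
have FL : F = [set [set v; u] | u in L].
  apply/setP=> e; apply/idP/imsetP => [eF|[u + ->]]; last by rewrite inE.
  have /edgesP[x [y [Gxy Ee]]] := subsetP FG e eF.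
  have := vF e eF; rewrite Ee !inE => /orP[] /eqP Ev.
    by exists y; rewrite ?inE Ev -?Ee.
  by exists x; rewrite ?inE Ev setUC -?Ee.
have cL : #|L| = l.
  rewrite -cF FL card_in_imset // => u w uL wL; apply: set2_inj; exact: Lv.
pose f : {ffun option 'I_l -> T} := [ffun x : option 'I_l =>
  if x is Some i then enum_val (cast_ord (esym cL) i) else v].
have fN : f None = v by rewrite ffunE.
have fS i : f (Some i) \in L by rewrite ffunE; apply: enum_valP.
have fI : injective f.
  move=> [i|] [j|] //.
  - by rewrite !ffunE => /enum_val_inj /cast_ord_inj ->.
  - by move=> E; have := fS i; rewrite E fN (negPf vL).
  - by move=> E; have := fS j; rewrite -E fN (negPf vL).
apply/existsP; exists (f @: [set: _]); apply/andP; split.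
  apply/andP; split=> //; apply/forallP => e; apply/implyP => eF.
  move: (eF); rewrite FL => /imsetP[u uL Ee]; rewrite Ee.
  apply/subsetP => w; rewrite !inE => /orP[] /eqP ->.
    by rewrite -fN imset_f.
  have Eu : f (Some (cast_ord cL (enum_rank_in uL u))) = u.
    by rewrite ffunE cast_ordK enum_rankK_in.
  by rewrite -Eu imset_f.
apply/existsP; exists f; apply/and3P; split=> //; first exact/injectiveP.
apply/forallP => x; apply/forallP => y; apply/eqP.
case: x y => [i|] [j|] /=.
- apply/esym/negbTE/negP => H; have := vF _ H; rewrite !inE.
  by rewrite eq_sym (negPf (Lv _ (fS i))) eq_sym (negPf (Lv _ (fS j))).
- by rewrite fN setUC; have := fS i; rewrite inE => ->.
- by rewrite fN; have := fS j; rewrite inE => ->.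
- by apply/esym/negbTE/negP => /(subsetP FG)/edge_neq; rewrite eqxx.
Qed.

Lemma exists_subset_card (T : finType) (A : {set T}) l :
  l <= #|A| -> exists2 B : {set T}, B \subset A & #|B| = l.
Proof.
move=> le; have : 0 < #|[set B : {set T} | B \subset A & #|B| == l]|.
  by rewrite cards_draws bin_gt0.
by case/card_gt0P => B; rewrite inE => /andP[sBA /eqP cB]; exists B.
Qed.

Lemma partition_by_sizes (T : finType) (V : eqType) (h : T -> V)
    (L : seq (V * nat)) (A : {set T}) :
  (forall x, x \in L -> 0 < x.2) ->
  (forall v, \sum_(x <- L) (x.1 == v) * x.2 = #|[set e in A | h e == v]|) ->
  exists P : {set {set T}},
    [/\ partition P A,
        forall F, F \in P -> exists v, forall e, e \in F -> h e = v
      & forall l, #|[set F in P | #|F| == l]| = \sum_(x <- L) (x.2 == l)].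
Proof.
elim: L A => [|[v l] L IH] A pos H.
  have -> : A = set0.
    apply/setP => e; rewrite inE; apply/negP => eA.
    have := H (h e); rewrite big_nil => /esym/eqP; rewrite cards_eq0 => /eqP E.
    by have := in_set0 e; rewrite -E inE eA eqxx.
  exists set0; split; first by rewrite partition_set0.
    by move=> F; rewrite inE.
  move=> l; rewrite big_nil; apply/eqP; rewrite cards_eq0.
  by apply/eqP/setP => F; rewrite !inE.
have lH w : (v == w) * l + \sum_(x <- L) (x.1 == w) * x.2 =
    #|[set e in A | h e == w]| by rewrite -H big_cons.
have [|B sB cB] := @exists_subset_card _ [set e in A | h e == v] l.
  by rewrite -lH eqxx mul1n leq_addr.
have hB e : e \in B -> e \in A /\ h e = v.
  by move=> /(subsetP sB); rewrite inE => /andP[-> /eqP].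
have sBA : B \subset A by apply/subsetP => e /hB[].
have l0 : 0 < l by apply: (pos (v, l)); rewrite inE eqxx.
have B0 : B != set0 by rewrite -card_gt0 cB.
have [||P [partP hP cP]] := IH (A :\: B).
- by move=> x xL; apply: pos; rewrite inE xL orbT.
- move=> w; have := H w; rewrite big_cons /=.
  have [E|ne] := eqVneq v w.
    rewrite mul1n -cB -E => /eqP; rewrite -(cardsID B [set e in A | h e == v]).
    rewrite (setIidPr sB) eqn_add2l => /eqP ->; apply: eq_card => e.
    by rewrite !inE andbA.
  rewrite mul0n add0n => ->; apply: eq_card => e; rewrite !inE.
  case: (boolP (e \in B)) => //= /hB[_ ->].
  by rewrite (negPf ne) andbF.
have BP : B \notin P.
  apply/negP => BinP; have [e eB] := set0Pn _ B0.
  by have := subsetP (partitionS partP BinP) e eB; rewrite inE eB.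
exists (B |: P); split.
- have -> : A = B :|: (A :\: B) by rewrite setDE setUIr setUCr setIT;
  apply/esym/setUidPr.
  by apply: partitionU1 => //; rewrite -setI_eq0 setIDA setIC setDIl setDv
    setI0.
- move=> F /setU1P[->|/hP //]; exists v => e /hB[] //.
- move=> l'; rewrite big_cons /= -cP.
  have -> : [set F in B |: P | #|F| == l'] =
    (if l == l' then [set B] else set0) :|: [set F in P | #|F| == l'].
    apply/setP => F; rewrite !inE; case: eqVneq => [->|ne] /=.
      by rewrite cB; case: ifP; rewrite ?inE ?eqxx //= (negPf BP).
    by case: ifP => _; rewrite ?inE ?(negPf ne).
  rewrite cardsU; case: eqP => [E|_].
    rewrite cards1 (_ : _ :&: _ = set0) ?cards0 ?subn0 //.
    by apply/setP => F; rewrite !inE; case: eqP => // ->; rewrite (negPf BP).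
  by rewrite cards0 set0I cards0 subn0.
Qed.

Lemma tnth_uniq_inj (T : eqType) n (t : n.-tuple T) :
  uniq t -> injective (tnth t).
Proof. by move=> u; apply/tuple_uniqP. Qed.

Lemma sum_bool_card (T : finType) (Q : pred T) :
  \sum_u Q u = #|[set u | Q u]|.
Proof.
by rewrite -sum1_card [RHS]big_mkcond; apply: eq_bigr => u _; rewrite inE;
  case: (Q u).
Qed.

Lemma centred_decomposable I o b : centred I o b -> star_decomposable I.
Proof.
move=> [oC ba bs]; set G := sd_graph I.
pose V := 'I_(sd_n I); pose s := tnth (sd_s I).
have s_inj : injective s by apply: tnth_uniq_inj; apply: sd_s_uniq.
pose inE_ v (e : {set V}) := [exists u, [&& e == [set v; u], G v u & o v u]].
pose h e := [pick v | inE_ v e].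
have hE u v : G v u -> o v u -> h [set v; u] = Some v.
  move=> Gvu ovu; rewrite /h; case: pickP => [w|/(_ v)]; last first.
    by move/existsP; case; exists u; rewrite eqxx Gvu ovu.
  case/existsP=> x /and3P[/eqP E Gwx owx]; congr Some.
  have : w \in [set v; u] by rewrite E set21.
  rewrite !inE => /orP[/eqP //|/eqP wu]; subst w.
  have xv : x = v.
    apply: (@set2_inj _ u); first by apply: contraTneq Gwx => ->;
      rewrite adj_irr.
      by apply: contraTneq Gvu => ->; rewrite adj_irr.
    by rewrite -E setUC.
  by subst x; rewrite (oC _ _ Gvu) owx in ovu.
have hP e : e \in edges G -> exists v u, [/\ e = [set v; u], G v u & o v u].
  move=> /edgesP[u [v [Guv ->]]]; have := oC _ _ Guv.
  case ouv: (o u v); first by exists u, v.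
  move/esym/negbFE => ovu; exists v, u; split=> //; first by rewrite setUC.
  by rewrite adj_sym.
pose L := flatten [seq nseq (b x.2 x.1) (Some x.1, s x.2) |
                   x : V * 'I_(sd_d I)].
have sumL (F : option V * nat -> nat) :
    \sum_(x <- L) F x = \sum_v \sum_i b i v * F (Some v, s i).
  rewrite /L big_flatten /= big_map big_enum /= pair_big /=.
  by apply: eq_bigr => x _; rewrite big_nseq iter_addn_0 mulnC.
have [||P [partP PF cP]] := @partition_by_sizes _ _ h L (edges G).
- move=> x /flatten_mapP[y _]; rewrite mem_nseq => /andP[_ /eqP ->].
  exact: sd_s_pos.
- move=> [v|]; rewrite sumL; last first.
    rewrite big1 => [|v _]; last by rewrite big1 // => i _; rewrite mul0n muln0.
    apply/esym/eqP; rewrite cards_eq0; apply/eqP/setP => e; rewrite !inE.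
    by apply/negP => /andP[/hP[v [u [-> Gvu ovu]]]]; rewrite hE.
  rewrite (bigD1 v) //= [X in _ + X]big1 ?addn0 => [|w ne]; last first.
    rewrite big1 // => i _; rewrite (_ : (Some w == Some v) = false) ?mul0n
      ?muln0 //.
    by apply/negbTE.
  under eq_bigr do rewrite eqxx mul1n.
  rewrite bs (sum_bool_card (fun u => G v u && o v u)).
  rewrite -(@card_in_imset _ _ (fun u => [set v; u])); last first.
    move=> u w; rewrite !inE => /andP[Gvu _] /andP[Gvw _]; apply: set2_inj.
      by apply: contraTneq Gvu => ->; rewrite adj_irr.
    by apply: contraTneq Gvw => ->; rewrite adj_irr.
  apply: eq_card => e; rewrite inE; apply/imsetP/andP => [[u]|[eE /eqP he]].
    rewrite inE => /andP[Gvu ovu ->]; rewrite hE //; split=> //.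
    by apply/edgesP; exists v, u.
  have [w [u [E Gwu owu]]] := hP e eE.
  by move: he; rewrite E hE // => -[<-]; exists u; rewrite ?inE ?Gwu.
have starF F : F \in P -> exists v, [/\ F \subset edges G,
    forall e, e \in F -> v \in e & #|F| = #|F|].
  move=> FP; have FG := partitionS partP FP.
  have [[v|] Hv] := PF F FP; last first.
    have [e eF] := set0Pn _ (partition_neq0 partP FP).
    have [w [u [E Gwu owu]]] := hP e (subsetP FG e eF).
    by have := Hv e eF; rewrite E hE.
  exists v; split=> // e eF; have [w [u [E Gwu owu]]] := hP e (subsetP FG e eF).
  by have := Hv e eF; rewrite E hE // => -[<-]; rewrite set21.
exists P; split=> //.
  by move=> F FP; exists #|F|; apply/star_copyP; apply: starF.
move=> i; transitivity #|[set F in P | #|F| == s i]|.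
  apply: eq_card => F; rewrite !inE; case FP: (F \in P) => //=.
  apply/idP/eqP => [/star_copyP[v []] //|E]; apply/star_copyP.
  by rewrite -/(s i) -E; apply: starF.
rewrite cP sumL exchange_big (bigD1 i) //= [X in _ + X]big1 ?addn0 => [|j ne].
  by rewrite -ba; apply: eq_bigr => v _; rewrite eqxx muln1.
by rewrite big1 // => v _; case: eqP => [/s_inj E|_];
  [rewrite E eqxx in ne | rewrite muln0].
Qed.

Lemma decomposable_centred I : star_decomposable I -> exists o b, centred I o b.
Proof.
move=> [P [partP Pstar Pa]]; set G := sd_graph I in partP Pstar Pa.
pose V := 'I_(sd_n I); pose s := tnth (sd_s I).
have s_inj : injective s by apply: tnth_uniq_inj; apply: sd_s_uniq.
have /and3P[/eqP covP trivP P0] := partP.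
pose c (F : {set {set V}}) := [pick v | [forall e in F, v \in e]].
have cP F : F \in P -> exists2 v, c F = Some v & forall e, e \in F -> v \in e.
  move=> /Pstar[l /star_copyP[v [_ Hv _]]]; rewrite /c.
  case: pickP => [w /forall_inP Hw|/(_ v)/forall_inP []]; last exact: Hv.
  by exists w.
have copyE F i : F \in P -> edge_set_of_copy (star (s i)) G F = (#|F| == s i).
  move=> FP; apply/idP/eqP => [/star_copyP[v []] //|E]; apply/star_copyP.
  by have [l /star_copyP[v [h1 h2 h3]]] := Pstar F FP; exists v.
have {}Pa i : \sum_(F in P) (#|F| == s i) = tnth (sd_a I) i.
  rewrite -Pa -sum1_card big_mkcond [RHS]big_mkcond; apply: eq_bigr => F _.
  by rewrite inE; case FP: (F \in P) => //=; rewrite copyE //; case: eqP.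
have one (F : {set {set V}}) : F \in P -> \sum_i (#|F| == s i) = 1.
  pose m (F : {set {set V}}) := \sum_i (#|F| == s i).
  have m1 (F' : {set {set V}}) : m F' <= 1.
    move: F' => {}F.
    have [/existsP[i Ei]|] := boolP [exists i, #|F| == s i].
      rewrite /m (bigD1 i) //= Ei big1 // => j ne.
      by case: eqP => // E; rewrite (s_inj j i) ?eqxx // -E (eqP Ei) in ne.
    by rewrite negb_exists => /forallP ne; rewrite /m big1 // => i _;
      rewrite (negPf (ne i)).
  have E : \sum_(F in P) #|F| * m F = \sum_(F in P) #|F|.
    rewrite -(card_partition partP) -sd_total.
    under eq_bigr do rewrite big_distrr /=.
    rewrite exchange_big /=; apply: eq_bigr => i _.
    rewrite -Pa big_distrl /=; apply: eq_bigr => F' _.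
    by case: eqP => [->|_]; rewrite ?muln0 ?mul1n ?muln1.
  move=> FP; apply/eqP; rewrite -/(m F) eqn_leq m1 /= lt0n.
  apply/negP => /eqP m0; move/eqP: E; apply/negP; rewrite neq_ltn.
  rewrite (bigD1 F) //= [X in _ < X](bigD1 F) //= m0 muln0 add0n.
  rewrite -[X in X < _]add0n -addSn leq_add //.
    by rewrite card_gt0; apply: contraTneq FP => ->; rewrite (negPf P0).
  by apply: leq_sum => F' _; rewrite -[leqRHS]muln1 leq_mul2l m1 orbT.
exists (fun v u => c (pblock P [set v; u]) == Some v),
  (fun i v => \sum_(F in P) ((#|F| == s i) && (c F == Some v))); split.
- move=> u v Guv; rewrite [[set v; u]]setUC.
  set F := pblock P _.
  have eE : [set u; v] \in cover P by rewrite covP; apply/edgesP; exists u, v.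
  have FP : F \in P by apply: pblock_mem.
  have [w -> Hw] := cP F FP.
  have : w \in [set u; v] by apply: Hw; rewrite mem_pblock.
  have uv : u != v by apply: contraTneq Guv => ->; rewrite adj_irr.
  rewrite !inE /= => /orP[] /eqP ->; rewrite !(inj_eq Some_inj) eqxx.
    by rewrite (negPf uv).
  by rewrite eq_sym (negPf uv).
- move=> i; rewrite exchange_big /= -Pa; apply: eq_bigr => F FP.
  have [w -> _] := cP F FP; rewrite (bigD1 w) //= eqxx andbT [X in _ + X]big1
    ?addn0 // => v ne.
  by rewrite (inj_eq Some_inj) [w == v]eq_sym (negPf ne) andbF.
- move=> v.
  transitivity (\sum_(F in P | c F == Some v) #|F|).
    under eq_bigr do rewrite big_distrl /=.
    rewrite exchange_big /= [RHS]big_mkcondr; apply: eq_bigr => F FP.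
    case: ifP => _; last by rewrite big1 // => i _; rewrite andbF.
    rewrite -[RHS]muln1 -(one F FP) big_distrr; apply: eq_bigr => i _ /=.
    by rewrite andbT; case: eqP => [->|]; rewrite ?muln0 ?mul1n ?muln1.
  rewrite (sum_bool_card (fun u => G v u && (c (pblock P [set v;
    u]) == Some v))).
  rewrite -(@card_in_imset _ _ (fun u => [set v; u])); last first.
    move=> u w; rewrite !inE => /andP[Gvu _] /andP[Gvw _]; apply: set2_inj.
      by apply: contraTneq Gvu => ->; rewrite adj_irr.
    by apply: contraTneq Gvw => ->; rewrite adj_irr.
  set A := [set _ | u in _].
  have AE e : (e \in A) = (e \in edges G) && (c (pblock P e) == Some v).
    apply/imsetP/andP => [[u]|[eE ce]].
      rewrite inE => /andP[Gvu ce ->]; split=> //.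
      by apply/edgesP; exists v, u.
    have eP : e \in cover P by rewrite covP.
    have [w Ew Hw] := cP _ (pblock_mem eP).
    have wv : w = v by move: ce; rewrite Ew => /eqP[].
    subst w; have : v \in e by apply: Hw; rewrite mem_pblock.
    have [x [y [Gxy Exy]]] := edgesP _ _ eE.
    rewrite Exy !inE => /orP[] /eqP vE; [subst x|subst y].
      by exists y => //; rewrite inE Gxy -Exy.
    exists x; last by rewrite setUC.
    by rewrite inE adj_sym Gxy setUC -Exy.
  rewrite (@card_partition _ [set F in P | c F == Some v] A).
    by apply: eq_bigl => F; rewrite inE.
  apply/and3P; split.
  - apply/eqP/setP => e; rewrite AE -covP; apply/bigcupP/andP.
      case=> F; rewrite inE => /andP[FP cF] eF; split.
        by apply/bigcupP; exists F.
      by rewrite (def_pblock trivP FP eF).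
    case=> eP ce; exists (pblock P e); last by rewrite mem_pblock.
    by rewrite inE pblock_mem.
  - apply: trivIsetS trivP; apply/subsetP => F; rewrite inE => /andP[] //.
  - by rewrite inE (negPf P0).
Qed.

(** * Deciding with a given cover *)

Lemma card_edges_le n (G : sgraph 'I_n) : #|edges G| <= n * n.
Proof.
apply: leq_trans (leq_imset_card _ _) _.
by apply: leq_trans (max_card _) _; rewrite card_prod card_ord.
Qed.

Definition run_time (n k : nat) : nat :=
  if k == 0 then 6 else
  6 + 2000 * ((n.+1 + (n * (n + n)).+1) *
    (k.+1 * (k.+1 * (k.+1 * (n * (n + n)).+1 ^ (k + k)).+1))).

Lemma no_edges_decomposable I : #|edges (sd_graph I)| = 0 -> star_decomposable
  I.
Proof.
move=> E0; have d0 (i : 'I_(sd_d I)) : False.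
  move: (sd_total I); rewrite E0 (bigD1 i) //= => /eqP.
  rewrite addn_eq0 muln_eq0 => /andP[/orP[] /eqP E _].
    by have := sd_a_pos i; rewrite E.
  by have := sd_s_pos i; rewrite E.
exists set0; split.
- by rewrite (cards0_eq E0) partition_set0.
- by move=> F; rewrite inE.
- by move=> i; case: (d0 i).
Qed.

Lemma halts_decide I (X : seq 'I_(sd_n I)) m :
  uniq X -> vertex_cover (sd_graph I) [set x in X] ->
  input (inst_of X) m -> (forall i, m 6 i = 0) -> (forall i, m 8 i = 0) ->
  halts prog_main m (run_time (sd_n I) (size X)) (fun m' =>
    (output m' = 1 /\ star_decomposable I) \/
    (output m' = 0 /\ ~ star_decomposable I)).
Proof.
move=> uX cov HI Z6 Z8; set J := inst_of X.
have [k0|k0] := posnP (size X).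
  apply: (@halts_time _ _ (2 + 3).+1); last by rewrite /run_time k0.
  apply: halts_if => [|_]; first by rewrite /= (in_k HI) /= k0.
  apply: halts_write; left; split=> //; apply: no_edges_decomposable.
  apply/eqP; rewrite cards_eq0; apply/eqP/setP => e; rewrite inE.
  apply/negP => /edgesP[u [v [Guv _]]]; have := vertex_coverP cov Guv.
  by rewrite (size0nil k0) => /(_ isT).
have psE (i : 'I_(sd_d I)) : ps J i = tnth (sd_s I) i by rewrite (tnth_nth 0).
have paE (i : 'I_(sd_d I)) : pa J i = tnth (sd_a I) i by rewrite (tnth_nth 0).
have total : \sum_(i < pd J) pa J i * ps J i <= pn J * pn J.
  under eq_bigr do rewrite paE psE.
  by rewrite sd_total card_edges_le.
have a_le i : i < pd J -> 0 < ps J i /\ pa J i * ps J i <= pn J * pn J.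
  move=> lti; rewrite -[i]/(val (Ordinal lti)).
  split; first by rewrite psE sd_s_pos.
  apply: leq_trans total; rewrite (bigD1 (Ordinal lti)) //= leq_addr //.
have sumS : \sum_(i < pd J) (pa J i).+1 <= pn J * (pn J + pn J).
  rewrite mulnDr; under eq_bigr do rewrite -addn1.
  rewrite big_split /=; apply: leq_add; apply: leq_trans total;
    apply: leq_sum => i _.
    by rewrite leq_pmulr //; case: (a_le i).
  by rewrite paE psE muln_gt0 sd_a_pos sd_s_pos.
have lek : size X <= sd_n I.
  by rewrite -(card_uniqP uX) -[leqRHS]card_ord max_card.
have ltx j : j < pk J -> px J j < pn J.
  by move=> ltj; rewrite /= (nth_map (tnth (in_tuple X) (Ordinal k0))).
have le_top i : i < pd J -> 0 < ps J i <= top J.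
  move=> lti; have [s0 le] := a_le i lti; rewrite s0 /=.
  have a0 : 0 < pa J i by rewrite -[i]/(val (Ordinal lti)) paE sd_a_pos.
  apply: leq_trans (big_le_top J); apply: (@leq_trans (base J)).
    by apply: leq_trans (_ : pa J i * ps J i <= _);
      [rewrite leq_pmull|rewrite /base; lia].
  rewrite -[base J]expn1; apply: (leq_trans _ (@wt_le_big J 1 _)) => //.
  by rewrite (leq_trans k0) ?leq_addr.
apply: (halts_weak (@halts_main J m k0 ltx le_top HI Z6 Z8)).
  rewrite /run_time gtn_eqF //.
  apply: leq_trans (leq_addl 6 _); rewrite leq_mul2l /= leq_mul2r.
  by apply/orP; right; rewrite leq_add2l ltnS.
have E : reach (ops J) 0 0 <-> star_decomposable I.
  rewrite reach_feasible //; first last.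
  - by move=> i /a_le[].
  - by rewrite k0.
  split=> [/(feasible_centred uX cov k0)[o [b /centred_decomposable //]]|].
  by move=> /decomposable_centred[o [b]]; apply: centred_feasible.
by move=> m' [[O R]|[O R]]; [left|right]; rewrite -E.
Qed.

Lemma input_cover I (X : seq 'I_(sd_n I)) m :
  (forall b i, b < 4 -> m b i = load (sd_encode I) b i) ->
  m 4 0 = size X -> (forall j, j < size X -> m 5 j = nth 0 (map val X) j) ->
  input (inst_of X) m.
Proof.
move=> E E4 E5; split=> //; try by [rewrite E|move=> *; rewrite E].
Qed.

Lemma power_le n k : 0 < k <= n ->
  n ^ 2 * k ^ 3 * (n * (n + n)).+1 ^ (k + k) <=
  4 * ((n + 5 ^ k) ^ (5 ^ k) * n ^ k).
Proof.
move=> /andP[k0 lekn]; set Y := n + 5 ^ k.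
have base_le : (n * (n + n)).+1 <= 2 * (n.+1) ^ 2 by rewrite -mulnn; nia.
apply: leq_trans (leq_mul (leqnn _) (_ : _ <= (2 * n.+1 ^ 2) ^ (k + k))) _.
  by rewrite leq_exp2r // addn_gt0 k0.
rewrite expnMn -expnM; have ltk5 : k < 5 ^ k by apply: ltn_expl.
have ltY : n < Y by rewrite /Y -addn1 leq_add2l; lia.
move: k0; rewrite leq_eqVlt => /orP[/eqP k1|k2].
  rewrite -k1 exp1n muln1 expn1 -[2 ^ (1 + 1)]/4 mulnCA leq_mul2l /=.
  rewrite expnS expn1 -mulnA mulnC leq_mul2r; apply/orP; right.
  rewrite (expnS Y 4); apply: leq_mul; first exact: ltnW.
  by rewrite leq_exp2r.
apply: (@leq_trans (Y ^ (5 ^ k) * n ^ k)); last by rewrite leq_pmull.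
have Y0 : 0 < Y by apply: leq_ltn_trans ltY.
have four : 2 ^ (k + k) <= Y.
  rewrite addnn -mul2n expnM; apply: leq_trans (leq_addl _ _).
  by rewrite leq_exp2r // ltnW.
have exps : 3 + (1 + 2 * (k + k)) <= 5 ^ k.
  elim: (k) k2 => [//|[//|[//|j]] IH] _; rewrite expnS.
  by have := IH isT; lia.
rewrite -mulnA mulnC; apply: leq_mul; last by rewrite leq_pexp2l //; lia.
apply: (@leq_trans (Y ^ (3 + (1 + 2 * (k + k))))); last by rewrite leq_pexp2l.
rewrite [Y ^ (3 + _)]expnD [Y ^ (1 + _)]expnD expn1; apply: leq_mul.
  by rewrite leq_exp2r // (leq_trans lekn) // ltnW.
by apply: leq_mul => //; rewrite leq_exp2r ?muln_gt0 ?addn_gt0 ?(ltnW k2) //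
  ltnW.
Qed.

Lemma run_time_le n k : k <= n ->
  run_time n k <= 2001 * (240 * ((n + 5 ^ k) ^ (5 ^ k) * n ^ k)).
Proof.
move=> lekn; have [->|k0] := posnP k.
  by rewrite /run_time /= !expn0 expn1; lia.
have le : n ^ 2 * k ^ 3 * (n * (n + n)).+1 ^ (k + k) <=
    4 * ((n + 5 ^ k) ^ (5 ^ k) * n ^ k) by apply: power_le; rewrite k0.
set Z := (_ * _) in le; rewrite /run_time gtn_eqF //.
set P := _ ^ (k + k) in Z le *; set D := _ * n ^ k in le *.
have P0 : 0 < P by rewrite expn_gt0.
have le1 : n.+1 + (n * (n + n)).+1 <= 5 * n ^ 2 by rewrite -mulnn; nia.
have le2 : (k.+1 * P).+1 <= 3 * (k * P) by nia.
have le3 : k.+1 * (k.+1 * (k.+1 * P).+1) <= (2 * k) * ((2 * k) * (3 * (k * P))).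
  by do 2?apply: leq_mul => //; lia.
have le4 : (n.+1 + (n * (n + n)).+1) * (k.+1 * (k.+1 * (k.+1 * P).+1)) <= 60 *
  Z.
  apply: leq_trans (leq_mul le1 le3) _.
  rewrite (_ : 60 * Z = 5 * n ^ 2 * (2 * k * (2 * k * (3 * (k * P))))) //.
  by rewrite /Z !expnS !expn0; lia.
have Z0 : 0 < Z by rewrite /Z !muln_gt0 !expn_gt0 k0 (leq_trans k0 lekn).
lia.
Qed.

Lemma decide_given_cover : exists (p : cmd) (C : nat),
  forall (I : sd_instance) (X : seq 'I_(sd_n I)),
    uniq X -> vertex_cover (sd_graph I) [set x in X] ->
    decides_within p (sd_encode_cover X)
      (C * ((sd_n I + 5 ^ size X) ^ (5 ^ size X) * sd_n I ^ size X))
      (star_decomposable I).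
Proof.
exists prog_main, (2001 * 240) => I X uX cov.
have HI : input (inst_of X) (load (sd_encode_cover X)).
  apply: input_cover => //; by case=> [|[|[|[|[|]]]]].
have [t [m [ex le out]]] := halts_decide uX cov HI (nth_nil 0) (nth_nil 0).
exists t, m; split=> //; apply: leq_trans le _; rewrite -mulnA.
apply: run_time_le; rewrite -(card_uniqP uX) -[leqRHS]card_ord.
exact: max_card.
Qed.

(** * Finding a cover *)

Definition prog_pick (x : nat) : cmd :=
  Seq (Write 28 (Var x) (Lit 1))
  (Seq (Write 5 (Var 4) (Var x)) (assign 4 (Var 4 [+] Lit 1))).

Definition prog_matching : cmd :=
  Seq (assign 27 (Lit 0))
  (For 18 (Var 0) (For 19 (Var 0)
    (Seq
      (If (Read 1 (Var 27))
        (If (Read 28 (Var 18) [+] Read 28 (Var 19)) Skip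
          (Seq (prog_pick 18) (prog_pick 19)))
        Skip)
      (assign 27 (Var 27 [+] Lit 1))))).

(* Every edge of a matching needs its own cover vertex, hence the last clause.
  *)
Definition matched (A : nat -> nat -> bool) (n : nat) (m : memory)
    (xs : seq nat) : Prop :=
  [/\ m 4 0 = size xs,
      forall t, t < size xs -> m 5 t = nth 0 xs t,
      forall v, (m 28 v != 0) = (v \in xs),
      uniq xs /\ all (fun v => v < n) xs
    & forall C : pred nat,
        (forall u v, u < n -> v < n -> A u v -> C u || C v) ->
        size xs <= 2 * count C xs].

Definition hit (A : nat -> nat -> bool) (xs : seq nat) (u v : nat) : Prop :=
  A u v -> (u \in xs) || (v \in xs).

Lemma halts_pick x m (Q : memory -> Prop) :
  x \notin [:: 4; 5; 28] ->
  (forall m', agree [:: 4; 5; 28] m m' -> m' 4 0 = (m 4 0).+1 ->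
     (forall t, m' 5 t = if t == m 4 0 then m x 0 else m 5 t) ->
     (forall v, m' 28 v = if v == m x 0 then 1 else m 28 v) -> Q m') ->
  halts (prog_pick x) m 16 Q.
Proof.
rewrite !inE !negb_or => /and3P[n4 n5 n28] HQ.
have [/negPf e4 /negPf e5 /negPf e28] := And3 n4 n5 n28.
apply: (@halts_time _ _ (4 + (5 + 6))) => //.
apply: halts_seq; apply: halts_write; apply: halts_seq; apply: halts_write;
  apply: halts_write.
apply: HQ.
- by do 3?apply: agree_update.
- by rewrite update_eq /= /update /= addn1.
- by move=> t; rewrite /update /= e28 /=.
- by move=> v; rewrite /update /=.
Qed.

Lemma halts_matching (A : nat -> nat -> bool) n m (Q : memory -> Prop) :
  m 0 0 = n ->
  (forall u v, u < n -> v < n -> (m 1 (u * n + v) != 0) = A u v) ->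
  (forall u, u < n -> A u u = false) ->
  m 4 0 = 0 -> (forall v, m 28 v = 0) ->
  (forall m' xs, agree [:: 4; 5; 18; 19; 27; 28] m m' -> matched A n m' xs ->
     (forall u v, u < n -> v < n -> hit A xs u v) -> Q m') ->
  halts prog_matching m (100 * (n.+1 * n.+1)) Q.
Proof.
move=> En EA Airr E4 E28 HQ; pose L := [:: 4; 5; 18; 19; 27; 28].
apply: (@halts_time _ _ (3 + (n * (n * (60 + (2 + 12)) + (2 + 12) + (2 + 12)) +
  (2 + 12))));
  last by nia.
apply: halts_seq; apply: halts_write => /=; set m0 := update _ _ _ _.
have A0 : agree L m m0 by apply: agree_update.
apply: (@halts_for_const _ _ _ n _ (fun i m1 => [/\ agree L m m1, m1 27 0 = i *
  n &
  exists2 xs, matched A n m1 xs & forall u v, u < i -> v < n -> hit A xs u v])).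
- move=> i m1 w [ag E [xs M H]]; split=> //; first exact: agree_update.
  by exists xs.
- by move=> i m1 [ag _ _] /=; rewrite ag.
- split=> //; exists [::] => //; split=> //.
  by move=> v; rewrite /m0 /update /= E28.
- move=> i m1 lti [ag1 E1 [xs1 M1 H1]] x1.
  apply: (@halts_for_const _ _ _ n _ (fun j m2 => [/\ agree L m m2,
    m2 18 0 = i, m2 27 0 = i * n + j &
    exists2 xs, matched A n m2 xs & forall u v, v < n -> u < i \/ u = i /\ v <
      j ->
      hit A xs u v])).
  + move=> j m2 w [ag E18 E27 [xs M H]]; split=> //; first exact: agree_update.
    by exists xs.
  + by move=> j m2 [ag _ _ _] /=; rewrite ag.
  + split; rewrite ?addn0 //; exists xs1 => // u v ltv [ltu|[_ //]].
    exact: H1.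
  + move=> j m2 ltj [ag2 E18 E27 [xs M H]] E19.
    pose post m3 := [/\ agree L m m3, m3 18 0 = i, m3 19 0 = j, m3 27 0 = i * n
      + j &
      exists2 xs, matched A n m3 xs & forall u v, v < n -> u < i \/ u = i /\ v
        < j.+1 ->
      hit A xs u v].
    apply: (@halts_time _ _ (50 + 6)) => //; apply: halts_seq.
    apply: (@halts_weak _ _ _ _ post); last first.
    * move=> m3 [ag3 h18 h19 h27 [xs3 M3 H3]].
      apply: halts_write; split; first by rewrite /update /= h19.
      split; [exact: agree_update | exact: h18 | | by exists xs3].
      by rewrite update_eq /= h27 addn1 addnS.
    * exact: leqnn.
    have keep : (A i j -> (i \in xs) || (j \in xs)) -> post m2.
      move=> Hij; split=> //; exists xs => // u v ltv [ltu|[-> ltvj]].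
        by apply: H => //; left.
      move: ltvj; rewrite ltnS leq_eqVlt => /orP[/eqP -> //|ltvj].
      by apply: H => //; right.
    have EAij : (m2 1 (i * n + j) != 0) = A i j by rewrite ag2 // EA.
    have [M4 M5 M28 [Mu Mn] MC] := M.
    apply: (@halts_time _ _ (3 + (7 + (16 + 16)).+1).+1) => //.
    apply: halts_if => /=; rewrite E27; last first.
      move=> z; apply: (@halts_time _ _ 1) => //; apply: halts_skip;
        apply: keep.
      by rewrite -EAij z.
    rewrite EAij => Aij; apply: halts_if => /=; rewrite E18 E19.
      move=> nz; apply: (@halts_time _ _ 1) => //; apply: halts_skip;
        apply: keep => _.
      by rewrite -!M28; case: (m2 28 i) (m2 28 j) nz => [|?] [|?].
    move=> /eqP; rewrite addn_eq0 => /andP[zi zj].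
    have ni : i \notin xs by rewrite -M28 zi.
    have nj : j \notin xs by rewrite -M28 zj.
    have ij : i != j by apply: contraTneq Aij => ->; rewrite Airr.
    apply: halts_seq; apply: halts_pick => // m3 ag3 F4 F5 F28.
    apply: halts_pick => // m4 ag4 G4 G5 G28.
    rewrite E18 in F5 F28; rewrite F4 in G4 G5.
    rewrite [m3 19 0]ag3 // E19 in G5 G28; rewrite M4 in F5 G4 G5.
    split.
    * exact: agree_step (agree_step _ ag2 ag3) ag4.
    * by rewrite ag4 // ag3.
    * by rewrite ag4 // ag3.
    * by rewrite ag4 // ag3.
    exists (rcons (rcons xs i) j).
      split.
      - by rewrite !size_rcons.
      - move=> t; rewrite !size_rcons => ltt; rewrite G5 F5 nth_rcons
        size_rcons nth_rcons.
        case: (ltngtP t (size xs)) => [lt|gt|->].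
        + by rewrite (ltn_trans lt) // ltn_eqF ?M5 // ltnS ltnW.
        + have -> : t = (size xs).+1 by lia.
          by rewrite eqxx ltnn.
        + by rewrite ltn_eqF // ltnSn.
      - move=> v; rewrite G28 F28 !(mem_rcons, inE) -M28.
        by case: (v == j) => //; case: (v == i).
      - split; last by rewrite !all_rcons ltj lti.
        by rewrite !rcons_uniq mem_rcons inE negb_or eq_sym ij nj ni.
      - move=> C HC; rewrite !size_rcons -!cats1 !count_cat /= !addn0.
        have := MC C HC; have := HC _ _ lti ltj Aij.
        by case: (C i) (C j) => [] [] //= _; lia.
    move=> u v ltv c Auv; rewrite !(mem_rcons, inE).
    case: c => [ltu|[-> ltvj]]; last first.
      by rewrite eqxx !orbT.
    by have := H u v ltv (or_introl ltu) Auv; case/orP => ->; rewrite !orbT.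
  move=> m2 [ag2 E18 E27 [xs M H]]; split=> //; split=> //.
    by rewrite E27 mulSn addnC.
  exists xs => // u v; rewrite ltnS leq_eqVlt => /orP[/eqP ->|ltu] ltv.
    by apply: H => //; right.
  by apply: H => //; left.
- by move=> m1 [ag _ [xs M H]]; apply: HQ M H.
Qed.

Lemma ord_seq n (xs : seq nat) :
  all (fun v => v < n) xs -> exists X : seq 'I_n, map val X = xs.
Proof.
elim: xs => [|x xs IH] /=; first by exists [::].
by move=> /andP[ltx /IH[X <-]]; exists (Ordinal ltx :: X).
Qed.

Lemma vc_number_cover (T : finType) (G : sgraph T) :
  exists2 Y, vertex_cover G Y & #|Y| = vc_number G.
Proof.
rewrite /vc_number; case: arg_minnP => [|Y cY _]; last by exists Y.
by apply/forallP => x; apply/forallP => y; rewrite !inE implybT.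
Qed.

Lemma exp_le_self x N : 2 <= N -> 2 ^ x <= N ^ x.
Proof. by case: x => // x le; rewrite leq_exp2r. Qed.

Lemma run_time_poly n k N :
  n.+1 <= N -> n * n + 2 <= N -> k <= n ->
  100 * (n.+1 * n.+1) + run_time n k <= N ^ (4 * k + 18).
Proof.
move=> leN leN2 lek; have N2 : 2 <= N by lia.
set E := N ^ (4 * k + 4).
have base_le : (n * (n + n)).+1 <= N ^ 2 by rewrite -mulnn; nia.
have pow_le : (n * (n + n)).+1 ^ (k + k) <= N ^ (4 * k).
  apply: (@leq_trans ((N ^ 2) ^ (k + k))).
    by case: (k + k) => // j; rewrite leq_exp2r.
  by rewrite -expnM; apply: leq_pexp2l; lia.
have N0 : 0 < N by lia.
have NE : N ^ 2 <= E by apply: leq_pexp2l; lia.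
have sq : n.+1 * n.+1 <= E by apply: leq_trans NE; rewrite -mulnn;
  apply: leq_mul.
have prod : (n.+1 + (n * (n + n)).+1) *
    (k.+1 * (k.+1 * (k.+1 * (n * (n + n)).+1 ^ (k + k)).+1)) <= 6 * E.
  apply: (@leq_trans ((3 * N) * (N * (N * (2 * (N * N ^ (4 * k))))))).
    apply: leq_mul; first by lia.
    do 2!(apply: leq_mul; first by lia).
    have le : k.+1 * (n * (n + n)).+1 ^ (k + k) <= N * N ^ (4 * k).
      by apply: leq_mul => //; lia.
    have : 0 < N * N ^ (4 * k) by rewrite muln_gt0 N0 expn_gt0 N0.
    lia.
  by rewrite /E expnD (expnS N 3) (expnS N 2) (expnS N 1) expn1; lia.
apply: (@leq_trans (2 ^ 14 * E)); last first.
  rewrite -[4 * k + 18]/(4 * k + (4 + 14)) addnA expnD -/E mulnC.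
  by rewrite leq_mul2l exp_le_self ?orbT.
have E0 : 0 < E by rewrite expn_gt0 N0.
have : run_time n k <= 6 + 2000 * (6 * E).
  rewrite /run_time; case: eqP => _; first by lia.
  by rewrite leq_add2l leq_mul2l prod orbT.
have -> : 2 ^ 14 * E = 128 * (128 * E) by rewrite mulnA.
lia.
Qed.

Lemma sd_in_XP : in_XP sd_encode star_decomposable sd_vc.
Proof.
exists (fun=> 1), (fun k => 8 * k + 18), (Seq prog_matching prog_main); split.
- exists (assign 0 (Lit 1)) => k; do 2!eexists; split; first exact: exec_write.
  by [].
- pose e2 e := e [+] e.
  exists (assign 0 (e2 (e2 (e2 (Var 0))) [+] Lit 18)) => k.
  do 2!eexists; split; first exact: exec_write.
  by rewrite /output update_eq /= /load /=; lia.
move=> I; pose n := sd_n I; pose G := sd_graph I.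
pose A u v := nth 0 (adj_matrix G) (u * n + v) != 0.
have AE (u v : 'I_n) : A u v = G u v.
  by rewrite /A nth_adj_matrix; case: (G u v).
pose m0 := load (sd_encode I).
pose bound := input_size (sd_encode I) ^ (8 * sd_vc I + 18).
suff [t [m [ex le out]]] : halts (Seq prog_matching prog_main) m0 bound (fun m'
  =>
    (output m' = 1 /\ star_decomposable I) \/
    (output m' = 0 /\ ~ star_decomposable I)).
  by exists t, m; split; rewrite ?mul1n.
have sizeE : n * n + 2 <= input_size (sd_encode I).
  rewrite /input_size /= size_allpairs !size_enum_ord -/n.
  by rewrite addnC leq_add2l leq_addr.
set N := input_size _ in sizeE *.
have leN : n.+1 <= N by nia.
have leB k : k <= n -> k <= 2 * sd_vc I ->
    100 * (n.+1 * n.+1) + run_time n k <= bound.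
  move=> lekn lek; apply: leq_trans (run_time_poly leN sizeE lekn) _.
  by apply: leq_pexp2l; lia.
have leT : 100 * (n.+1 * n.+1) <= bound by apply: leq_trans (leB 0 _ _); lia.
rewrite -(subnKC leT); apply: halts_seq; apply: (halts_matching (A := A)) => //.
- by move=> u ltu; rewrite -[u]/(val (Ordinal ltu)) AE adj_irr.
- by move=> v; apply: nth_nil.
move=> m1 xs ag [M4 M5 _ [uxs all_n] MC] H.
have [X EX] := ord_seq all_n.
have uX : uniq X by rewrite -(map_inj_uniq val_inj) EX.
have sX : size X = size xs by rewrite -EX size_map.
have cov : vertex_cover G [set x in X].
  apply/forallP => u; apply/forallP => v; apply/implyP => Guv; rewrite !inE.
  have := H u v (ltn_ord u) (ltn_ord v); rewrite /hit AE Guv => /(_ isT).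
  by rewrite -EX !(mem_map val_inj).
have lek : size X <= 2 * sd_vc I.
  rewrite /sd_vc; have [Y /forallP cY <-] := vc_number_cover (sd_graph I).
  apply: leq_trans (_ : 2 * count (mem (map val (enum Y))) xs <= _).
    rewrite sX; apply: MC => u v ltu ltv.
    rewrite -[u]/(val (Ordinal ltu)) -[v]/(val (Ordinal ltv)) AE => Guv.
    have /forallP/(_ (Ordinal ltv))/implyP/(_ Guv) := cY (Ordinal ltu).
    by case/orP=> inY; apply/orP; [left|right]; apply/mapP;
      [exists (Ordinal ltu)|exists (Ordinal ltv)]; rewrite ?mem_enum.
  rewrite leq_mul2l /= -EX count_map.
  rewrite (@eq_count _ _ (mem Y)); last first.
    by move=> v /=; rewrite (mem_map val_inj) mem_enum.
  rewrite -size_filter cardE uniq_leq_size ?filter_uniq // => v.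
  by rewrite mem_filter mem_enum => /andP[].
have lekn : size X <= n by rewrite -(card_uniqP uX) -[leqRHS]card_ord max_card.
apply: (halts_time (T := run_time n (size X))).
  apply: (halts_decide uX cov).
  - apply: input_cover; first by move=> [|[|[|[|]]]] // i _; rewrite ag.
      by rewrite M4 sX.
    by move=> j ltj; rewrite EX M5 // -sX.
  - by move=> i; rewrite ag //; apply: nth_nil.
  - by move=> i; rewrite ag //; apply: nth_nil.
by have := leB _ lekn lek; lia.
Qed.

Theorem theorem11 :
  in_XP sd_encode star_decomposable sd_vc
  /\
  exists (p : cmd) (C : nat),
    forall (I : sd_instance) (X : seq 'I_(sd_n I)),
      uniq X -> vertex_cover (sd_graph I) [set x in X] -> size X = sd_vc I ->
      let n := sd_n I in
      let vc := sd_vc I in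
      decides_within p (sd_encode_cover X)
        (C * ((n + 5 ^ vc) ^ (5 ^ vc) * n ^ vc))
        (star_decomposable I).
Proof.
split; first exact: sd_in_XP.
have [p [C HpC]] := decide_given_cover.
by exists p, C => I X uX cov sX /=; rewrite -sX; apply: HpC.
Qed.
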